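(* Let $\mathcal{A}$ be an abelian category which is Frobenius exact and let $N\ge 2$ be an integer. Then the triangulated functor $\overline{F}: K_N^{ac}(\operatorname{Proj}(\mathcal{A}))\to \operatorname{stab}_N(\mathcal{A})$ induced by $$F(P^\bullet)= Z^0_1(P^\bullet)\hookrightarrow Z^0_2(P^\bullet)\hookrightarrow\cdots\hookrightarrow Z^0_{N-1}(P^\bullet)$$ is an equivalence.
   Context: An abelian category is regarded as an exact category with all short exact sequences admissible; it is Frobenius exact if it has enough projectives and enough injectives and projective and injective objects coincide. $\operatorname{Proj}(\mathcal{A})$ is the full subcategory of projective objects. An $N$-complex $X^\bullet$ over $\mathcal{A}$ is a sequence of objects $X^n$ ($n\in\mathbb{Z}$) with maps $d^n_X:X^n\to X^{n+1}$ such that any composition of $N$ successive maps is zero; morphisms are families of maps commuting with the differentials. $C_N(\mathcal{A})$ is the category of $N$-complexes. Write $d_X^{n,r}=d_X^{n+r-1}\cdots d_X^n$. For $1\le r<N$ put $Z^n_r(X^\bullet)=\ker(d_X^{n,r})$, $B^n_r(X^\bullet)=\operatorname{im}(d_X^{n-N+r,N-r})$, $H^n_r=Z^n_r/B^n_r$; $X^\bullet$ is acyclic if $H^n_r(X^\bullet)=0$ for all $n\in\mathbb{Z}$, $1\le r<N$. With the chainwise split exact sequences, $C_N(\mathcal{A})$ is a Frobenius exact category; its stable category is the triangulated homotopy category $K_N(\mathcal{A})$. Explicitly, a morphism $f^\bullet:X^\bullet\to Y^\bullet$ is zero in $K_N(\mathcal{A})$ iff there are $h^i:X^i\to Y^{i-N+1}$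 with $f^i=\sum_{j=1}^N d_Y^{i+j-N,N-j}h^{i+j-1}d_X^{i,j-1}$. $C_N^{ac}(\operatorname{Proj}(\mathcal{A}))$ (resp. $K_N^{ac}(\operatorname{Proj}(\mathcal{A}))$) is the full subcategory of $C_N(\mathcal{A})$ (resp. $K_N(\mathcal{A})$) of acyclic $N$-complexes with projective components. $\operatorname{MMor}_{N-2}(\mathcal{A})$ is the category of diagrams $X_1\hookrightarrow X_2\hookrightarrow\cdots\hookrightarrow X_{N-1}$ of monomorphisms in $\mathcal{A}$ (morphisms being natural transformations), with exact structure given by componentwise short exact sequences. It is Frobenius exact; the $N$-stable category $\operatorname{stab}_N(\mathcal{A})$ is its stable category (quotient by morphisms factoring through projective-injective objects), a triangulated category. The functor $F:C_N^{ac}(\operatorname{Proj}(\mathcal{A}))\to\operatorname{MMor}_{N-2}(\mathcal{A})$ is given by the displayed formula, the maps being the canonical inclusions. It preserves short exact sequences and sends projective-injective objects to projective-injective objects, hence induces the triangulated functor $\overline{F}$ on stable categories. *)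

(* Defs.v *)
Set Warnings "-notation-overridden,-ambiguous-paths,-redundant-canonical-projection".
From HB Require Import structures.
From mathcomp Require Import all_boot all_order all_algebra.
From mathcomp Require Import boolp.
From mathcomp Require Import zify.

Set Implicit Arguments.
Unset Strict Implicit.
Unset Printing Implicit Defensive.

Import Order.TTheory GRing.Theory Num.Theory.
Local Open Scope ring_scope.
Local Open Scope quotient_scope.

Record preadd := Preadd {
  ob :> Type;
  hom : ob -> ob -> zmodType;
  idm : forall X, hom X X;
  comp : forall X Y Z, hom Y Z -> hom X Y -> hom X Z;
  comp1m : forall X Y (f : hom X Y), comp (idm Y) f = f;
  compm1 : forall X Y (f : hom X Y), comp f (idm X) = f;
  compA : forall X Y Z W (h : hom Z W) (g : hom Y Z) (f : hom X Y),
    comp h (comp g f) = comp (comp h g) f;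
  compDl : forall X Y Z (g g' : hom Y Z) (f : hom X Y),
    comp (g + g') f = comp g f + comp g' f;
  compDr : forall X Y Z (g : hom Y Z) (f f' : hom X Y),
    comp g (f + f') = comp g f + comp g f' }.

Arguments hom {p} _ _.
Arguments idm {p} X.
Arguments comp {p X Y Z} _ _.

Notation "g ∘ f" := (comp g f) (at level 40, left associativity).

Section PreaddTheory.
Variable C : preadd.

Lemma comp0m (X Y Z : C) (f : hom X Y) : (0 : hom Y Z) ∘ f = 0.
Proof. by apply: (@addrI _ (0 ∘ f)); rewrite -compDl !addr0. Qed.

Lemma compm0 (X Y Z : C) (g : hom Y Z) : g ∘ (0 : hom X Y) = 0.
Proof. by apply: (@addrI _ (g ∘ 0)); rewrite -compDr !addr0. Qed.

Lemma compNl (X Y Z : C) (g : hom Y Z) (f : hom X Y) : (- g) ∘ f = - (g ∘ f).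
Proof. by apply: (@addrI _ (g ∘ f)); rewrite -compDl !subrr comp0m. Qed.

Lemma compNr (X Y Z : C) (g : hom Y Z) (f : hom X Y) : g ∘ (- f) = - (g ∘ f).
Proof. by apply: (@addrI _ (g ∘ f)); rewrite -compDr !subrr compm0. Qed.

Lemma compBl (X Y Z : C) (g g' : hom Y Z) (f : hom X Y) :
  (g - g') ∘ f = g ∘ f - g' ∘ f.
Proof. by rewrite compDl compNl. Qed.

Lemma compBr (X Y Z : C) (g : hom Y Z) (f f' : hom X Y) :
  g ∘ (f - f') = g ∘ f - g ∘ f'.
Proof. by rewrite compDr compNr. Qed.

Lemma comp_suml (X Y Z : C) (f : hom X Y) (I : Type) (r : seq I) (P : pred I)
    (F : I -> hom Y Z) :
  (\sum_(i <- r | P i) F i) ∘ f = \sum_(i <- r | P i) (F i ∘ f).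
Proof.
by apply: (big_morph (fun g => g ∘ f)) => [g g'|]; rewrite ?compDl ?comp0m.
Qed.

Lemma comp_sumr (X Y Z : C) (g : hom Y Z) (I : Type) (r : seq I) (P : pred I)
    (F : I -> hom X Y) :
  g ∘ (\sum_(i <- r | P i) F i) = \sum_(i <- r | P i) (g ∘ F i).
Proof.
by apply: (big_morph (fun f => g ∘ f)) => [f f'|]; rewrite ?compDr ?compm0.
Qed.

Definition is_iso (X Y : C) (f : hom X Y) :=
  exists g : hom Y X, g ∘ f = idm X /\ f ∘ g = idm Y.

Definition mono (X Y : C) (f : hom X Y) :=
  forall (W : C) (u v : hom W X), f ∘ u = f ∘ v -> u = v.

Definition epi (X Y : C) (f : hom X Y) :=
  forall (W : C) (u v : hom Y W), u ∘ f = v ∘ f -> u = v.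

End PreaddTheory.

Record functor (C D : preadd) := Functor {
  fob :> C -> D;
  fmap : forall X Y : C, hom X Y -> hom (fob X) (fob Y);
  fmap1 : forall X : C, fmap (idm X) = idm (fob X);
  fmapM : forall (X Y Z : C) (g : hom Y Z) (f : hom X Y),
    fmap (g ∘ f) = fmap g ∘ fmap f }.

Arguments fmap {C D} _ {X Y} _.

Definition idF (C : preadd) : functor C C :=
  @Functor C C id (fun _ _ f => f) (fun _ => erefl) (fun _ _ _ _ _ => erefl).

Section CompF.
Variables (C D E : preadd) (G : functor D E) (F : functor C D).

Lemma compF1 X : fmap G (fmap F (idm X)) = idm (G (F X)).
Proof. by rewrite !fmap1. Qed.

Lemma compFM (X Y Z : C) (g : hom Y Z) (f : hom X Y) :
  fmap G (fmap F (g ∘ f)) = fmap G (fmap F g) ∘ fmap G (fmap F f).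
Proof. by rewrite !fmapM. Qed.

Definition compF : functor C E :=
  @Functor C E (fun X => G (F X)) (fun _ _ f => fmap G (fmap F f)) compF1 compFM.

End CompF.

Definition nat_iso (C D : preadd) (F G : functor C D) :=
  exists eta : forall X : C, hom (F X) (G X),
    (forall (X Y : C) (f : hom X Y), fmap G f ∘ eta X = eta Y ∘ fmap F f) /\
    (forall X, is_iso (eta X)).

Definition is_equivalence (C D : preadd) (F : functor C D) :=
  exists G : functor D C,
    nat_iso (compF G F) (idF C) /\ nat_iso (compF F G) (idF D).

Definition additive_functor (C D : preadd) (F : functor C D) :=
  forall (X Y : C) (f g : hom X Y), fmap F (f + g) = fmap F f + fmap F g.

Section FullSub.
Variables (C : preadd) (P : C -> Prop).

Definition full_sub : preadd :=
  @Preadd {X : C | P X} (fun X Y => hom (sval X) (sval Y))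
    (fun X => idm (sval X)) (fun _ _ _ g f => g ∘ f)
    (fun _ _ => @comp1m C _ _) (fun _ _ => @compm1 C _ _)
    (fun _ _ _ _ => @compA C _ _ _ _)
    (fun _ _ _ => @compDl C _ _ _) (fun _ _ _ => @compDr C _ _ _).

End FullSub.

Record ideal (C : preadd) := Ideal {
  imem : forall X Y : C, hom X Y -> Prop;
  imem0 : forall X Y : C, imem (0 : hom X Y);
  imemB : forall (X Y : C) (f g : hom X Y), imem f -> imem g -> imem (f - g);
  imemL : forall (X Y Z : C) (g : hom Y Z) (f : hom X Y), imem f -> imem (g ∘ f);
  imemR : forall (X Y Z : C) (g : hom Y Z) (f : hom X Y), imem g -> imem (g ∘ f) }.

Arguments imem {C} _ {X Y} _.

Section Quotient.
Variables (C : preadd) (J : ideal C).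

Definition ipred (X Y : C) : {pred hom X Y} := fun f : hom X Y => `[< imem J f >].

(* transparent, so that KNacP_hom below holds by conversion *)
Fact ipred_zmod_closed (X Y : C) : zmod_closed (@ipred X Y).
Proof.
split=> [|f g /asboolP Jf /asboolP Jg]; apply/asboolP; first exact: imem0.
exact: imemB.
Defined.

Definition izmod (X Y : C) : zmodClosed (hom X Y) :=
  HB.pack_for (zmodClosed (hom X Y)) (@ipred X Y)
    (GRing.isZmodClosed.Build (hom X Y) (@ipred X Y) (ipred_zmod_closed X Y)).

Definition qhom (X Y : C) : zmodType := Quotient.quot (izmod X Y).

Definition cls (X Y : C) (f : hom X Y) : qhom X Y := \pi_(qhom X Y) f.

Lemma clsP (X Y : C) (f g : hom X Y) : cls f = cls g <-> imem J (f - g).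
Proof.
split=> [/eqP|Jfg]; first by rewrite -Quotient.idealrBE => /asboolP.
by apply/eqP; rewrite -Quotient.idealrBE; apply/asboolP.
Qed.

Lemma clsK (X Y : C) (a : qhom X Y) : cls (repr a) = a.
Proof. exact: reprK. Qed.

Lemma repr_cls (X Y : C) (f : hom X Y) : imem J (repr (cls f) - f).
Proof. by apply/clsP; rewrite clsK. Qed.

Lemma clsD (X Y : C) (f g : hom X Y) : cls (f + g) = cls f + cls g.
Proof. exact: (raddfD (\pi_(qhom X Y))). Qed.

Definition qcomp (X Y Z : C) (b : qhom Y Z) (a : qhom X Y) : qhom X Z :=
  cls (repr b ∘ repr a).

Lemma qcompE (X Y Z : C) (g : hom Y Z) (f : hom X Y) :
  qcomp (cls g) (cls f) = cls (g ∘ f).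
Proof.
apply/clsP; set g' := repr _; set f' := repr _.
have -> : g' ∘ f' - g ∘ f = (g' - g) ∘ f' - g ∘ (f - f').
  by rewrite compBl compBr opprB addrA subrK.
apply: imemB; first exact/imemR/repr_cls.
apply: imemL; rewrite -opprB -sub0r.
by apply: imemB; [exact: imem0 | exact: repr_cls].
Qed.

Fact qcomp1m (X Y : C) (a : qhom X Y) : qcomp (cls (idm Y)) a = a.
Proof. by rewrite -(clsK a) qcompE comp1m. Qed.

Fact qcompm1 (X Y : C) (a : qhom X Y) : qcomp a (cls (idm X)) = a.
Proof. by rewrite -(clsK a) qcompE compm1. Qed.

Fact qcompA (X Y Z W : C) (c : qhom Z W) (b : qhom Y Z) (a : qhom X Y) :
  qcomp c (qcomp b a) = qcomp (qcomp c b) a.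
Proof. by rewrite -(clsK a) -(clsK b) -(clsK c) !qcompE compA. Qed.

Fact qcompDl (X Y Z : C) (b b' : qhom Y Z) (a : qhom X Y) :
  qcomp (b + b') a = qcomp b a + qcomp b' a.
Proof.
by rewrite -(clsK a) -(clsK b) -(clsK b') -clsD !qcompE -clsD compDl.
Qed.

Fact qcompDr (X Y Z : C) (b : qhom Y Z) (a a' : qhom X Y) :
  qcomp b (a + a') = qcomp b a + qcomp b a'.
Proof.
by rewrite -(clsK a) -(clsK b) -(clsK a') -clsD !qcompE -clsD compDr.
Qed.

Definition quotient : preadd :=
  @Preadd C qhom (fun X => cls (idm X)) qcomp
    qcomp1m qcompm1 qcompA qcompDl qcompDr.

End Quotient.

Arguments cls {C} J {X Y} f.

Section InducedFunctor.
Variables (C D : preadd) (J : ideal C) (J' : ideal D) (F : functor C D).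

(* F descends to the quotients: congruent morphisms have congruent images. *)
Definition respects :=
  forall (X Y : C) (f g : hom X Y), imem J (f - g) -> imem J' (fmap F f - fmap F g).

Hypothesis hF : respects.

Definition ind_map (X Y : quotient J) (a : hom X Y) :
    @hom (quotient J') (F X) (F Y) :=
  cls J' (fmap F (repr a)).

Lemma ind_mapE (X Y : C) (f : hom X Y) : ind_map (cls J f) = cls J' (fmap F f).
Proof. by apply/clsP/hF; exact: repr_cls. Qed.

Fact ind_map1 (X : quotient J) : ind_map (idm X) = @idm (quotient J') (F X).
Proof. by rewrite [LHS](ind_mapE (@idm C X)) fmap1. Qed.

Fact ind_mapM (X Y Z : quotient J) (b : hom Y Z) (a : hom X Y) :
  ind_map (b ∘ a) = ind_map b ∘ ind_map a.
Proof.
rewrite -(clsK a) -(clsK b) [X in ind_map X = _]qcompE !ind_mapE.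
by rewrite [RHS]qcompE fmapM.
Qed.

Definition induced : functor (quotient J) (quotient J') :=
  @Functor (quotient J) (quotient J') F ind_map ind_map1 ind_mapM.

End InducedFunctor.

Section Abelian.
Variable C : preadd.

Definition is_zero (Z : C) :=
  (forall (X : C) (f : hom X Z), f = 0) /\ (forall (X : C) (f : hom Z X), f = 0).

Definition is_biproduct (X Y S : C) (i1 : hom X S) (i2 : hom Y S)
    (p1 : hom S X) (p2 : hom S Y) :=
  [/\ p1 ∘ i1 = idm X, p2 ∘ i2 = idm Y, p1 ∘ i2 = 0, p2 ∘ i1 = 0
    & i1 ∘ p1 + i2 ∘ p2 = idm S].

Definition additive :=
  (exists Z : C, is_zero Z) /\
  (forall X Y : C, exists (S : C) (i1 : hom X S) (i2 : hom Y S)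
     (p1 : hom S X) (p2 : hom S Y), is_biproduct i1 i2 p1 p2).

Definition is_kernel (X Y : C) (f : hom X Y) (K : C) (k : hom K X) :=
  f ∘ k = 0 /\
  forall (W : C) (g : hom W X), f ∘ g = 0 -> exists! u : hom W K, k ∘ u = g.

Definition is_cokernel (X Y : C) (f : hom X Y) (Q : C) (q : hom Y Q) :=
  q ∘ f = 0 /\
  forall (W : C) (g : hom Y W), g ∘ f = 0 -> exists! u : hom Q W, u ∘ q = g.

Definition abelian :=
  [/\ additive,
      forall (X Y : C) (f : hom X Y), exists (K : C) (k : hom K X), is_kernel f k,
      forall (X Y : C) (f : hom X Y), exists (Q : C) (q : hom Y Q), is_cokernel f q,
      forall (X Y : C) (m : hom X Y), mono m ->
        exists (Z : C) (f : hom Y Z), is_kernel f m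
    & forall (X Y : C) (e : hom X Y), epi e ->
        exists (W : C) (f : hom W X), is_cokernel f e].

End Abelian.

Record abcat := Abcat { abcarrier :> preadd; abcatP : abelian abcarrier }.

Section Chosen.
Variable A : abcat.

Lemma has_ker (X Y : A) (f : hom X Y) :
  exists (K : A) (k : hom K X), is_kernel f k.
Proof. by case: (abcatP A) => _ + _ _ _; apply. Qed.

Lemma has_coker (X Y : A) (f : hom X Y) :
  exists (Q : A) (q : hom Y Q), is_cokernel f q.
Proof. by case: (abcatP A) => _ _ + _ _; apply. Qed.

Definition Ker (X Y : A) (f : hom X Y) : A := sval (cid (has_ker f)).
Definition ker (X Y : A) (f : hom X Y) : hom (Ker f) X :=
  sval (cid (svalP (cid (has_ker f)))).
Definition kerP (X Y : A) (f : hom X Y) : is_kernel f (ker f) :=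
  svalP (cid (svalP (cid (has_ker f)))).

Definition Coker (X Y : A) (f : hom X Y) : A := sval (cid (has_coker f)).
Definition coker (X Y : A) (f : hom X Y) : hom Y (Coker f) :=
  sval (cid (svalP (cid (has_coker f)))).
Definition cokerP (X Y : A) (f : hom X Y) : is_cokernel f (coker f) :=
  svalP (cid (svalP (cid (has_coker f)))).

Definition Im (X Y : A) (f : hom X Y) : A := Ker (coker f).
Definition im (X Y : A) (f : hom X Y) : hom (Im f) Y := ker (coker f).

Definition klift (X Y W : A) (f : hom X Y) (g : hom W X) (fg0 : f ∘ g = 0) :
  hom W (Ker f) := sval (cid ((kerP f).2 W g fg0)).

Lemma kliftE (X Y W : A) (f : hom X Y) (g : hom W X) (fg0 : f ∘ g = 0) :
  ker f ∘ klift fg0 = g.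
Proof. by rewrite /klift; case: cid => u []. Qed.

Lemma ker_mono (X Y : A) (f : hom X Y) : mono (ker f).
Proof.
move=> W u v uv; have [fk kP] := kerP f.
have [|w [_ wP]] := kP W (ker f ∘ u); first by rewrite compA fk comp0m.
by rewrite -(wP u erefl) (wP v).
Qed.

Lemma comp_im0 (X Y Z : A) (f : hom X Y) (g : hom Y Z) :
  g ∘ f = 0 -> g ∘ im f = 0.
Proof.
move=> /((cokerP f).2 Z) [u [<- _]].
by rewrite -compA (kerP (coker f)).1 compm0.
Qed.

(* ker g / im f, for composable f and g with zero composite *)
Definition homology (X Y Z : A) (f : hom X Y) (g : hom Y Z) (gf0 : g ∘ f = 0) : A :=
  Coker (klift (comp_im0 gf0)).

End Chosen.

(* The axioms of an exact category are not part of the record: it only fixes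
   the class of admissible short exact sequences of the category at hand. *)
Record excat := Excat {
  excarrier :> preadd;
  conf : forall X Y Z : excarrier, hom X Y -> hom Y Z -> Prop }.

Arguments conf {e X Y Z} _ _.

Section Exact.
Variable E : excat.

Definition projective (P : E) :=
  forall (X Y Z : E) (i : hom X Y) (p : hom Y Z), conf i p ->
  forall f : hom P Z, exists g : hom P Y, p ∘ g = f.

Definition injective (I : E) :=
  forall (X Y Z : E) (i : hom X Y) (p : hom Y Z), conf i p ->
  forall f : hom X I, exists g : hom Y I, g ∘ i = f.

Definition projinj (P : E) := projective P /\ injective P.

Definition enough_projectives :=
  forall X : E, exists (K P : E) (i : hom K P) (p : hom P X),
    conf i p /\ projective P.

Definition enough_injectives :=
  forall X : E, exists (I S : E) (i : hom X I) (p : hom I S),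
    conf i p /\ injective I.

Definition frobenius :=
  [/\ enough_projectives, enough_injectives
    & forall X : E, projective X <-> injective X].

Definition factors_projinj (X Y : E) (f : hom X Y) :=
  exists (P : E) (a : hom X P) (b : hom P Y), projinj P /\ f = b ∘ a.

Section StableIdeal.
Hypothesis addE : additive E.

Lemma projinj_biprod (P Q S : E) (i1 : hom P S) (i2 : hom Q S)
    (p1 : hom S P) (p2 : hom S Q) :
  is_biproduct i1 i2 p1 p2 -> projinj P -> projinj Q -> projinj S.
Proof.
move=> [_ _ _ _ e] [pP iP] [pQ iQ]; split=> X Y Z i p cf f.
- have [g1 h1] := pP _ _ _ _ _ cf (f ∘ i1).
  have [g2 h2] := pQ _ _ _ _ _ cf (f ∘ i2).
  exists (g1 ∘ p1 + g2 ∘ p2).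
  by rewrite compDr !compA h1 h2 -!compA -compDr e compm1.
- have [g1 h1] := iP _ _ _ _ _ cf (p1 ∘ f).
  have [g2 h2] := iQ _ _ _ _ _ cf (p2 ∘ f).
  exists (i1 ∘ g1 + i2 ∘ g2).
  by rewrite compDl -!compA h1 h2 !compA -compDl e comp1m.
Qed.

Fact factors_projinj0 (X Y : E) : factors_projinj (0 : hom X Y).
Proof.
have [Z [Z1 Z2]] := addE.1; exists Z, 0, 0; split; last by rewrite comp0m.
split=> X' Y' Z' i p _ f; exists 0.
- by rewrite compm0 (Z2 _ f).
- by rewrite comp0m (Z1 _ f).
Qed.

Fact factors_projinjB (X Y : E) (f g : hom X Y) :
  factors_projinj f -> factors_projinj g -> factors_projinj (f - g).
Proof.
move=> [P [a [b [hP ->]]]] [Q [a' [b' [hQ ->]]]].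
have [S [i1 [i2 [p1 [p2 hS]]]]] := addE.2 P Q.
exists S, (i1 ∘ a - i2 ∘ a'), (b ∘ p1 + b' ∘ p2).
split; first exact: projinj_biprod hS hP hQ.
case: hS => e11 e22 e12 e21 _.
rewrite compDl !compBr -!compA !(compA p1) !(compA p2) e11 e22 e12 e21.
by rewrite !comp1m !comp0m !compm0 subr0 sub0r.
Qed.

Fact factors_projinjL (X Y Z : E) (g : hom Y Z) (f : hom X Y) :
  factors_projinj f -> factors_projinj (g ∘ f).
Proof. by move=> [P [a [b [hP ->]]]]; exists P, a, (g ∘ b); rewrite compA. Qed.

Fact factors_projinjR (X Y Z : E) (g : hom Y Z) (f : hom X Y) :
  factors_projinj g -> factors_projinj (g ∘ f).
Proof. by move=> [P [a [b [hP ->]]]]; exists P, (a ∘ f), b; rewrite compA. Qed.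

Definition stable_ideal : ideal E :=
  @Ideal E factors_projinj factors_projinj0 factors_projinjB
    factors_projinjL factors_projinjR.

Definition stable_category : preadd := quotient stable_ideal.

End StableIdeal.
End Exact.

(* Happel's triangulation of the stable category of a Frobenius category E,
   presented as the quotient of E by an ideal J.  The suspension depends on the
   choice of a conflation X -> I -> S X with I projective-injective for each X;
   different choices give isomorphic triangulated structures. *)
Section Triangles.
Variables (E : excat) (J : ideal E).
Let Q := quotient J.

Record suspension (X : E) := Suspension {
  sI : E;
  sS : E;
  s_in : hom X sI;
  s_out : hom sI sS;
  s_conf : conf s_in s_out;
  s_projinj : projinj sI }.

Variable s : forall X : E, suspension X.

(* graph of the suspension functor on morphisms: g = S(f) in Q *)
Definition susp_map (X Y : E) (f : @hom Q X Y) (g : @hom Q (sS (s X)) (sS (s Y))) :=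
  exists (f0 : hom X Y) (i0 : hom (sI (s X)) (sI (s Y)))
         (g0 : hom (sS (s X)) (sS (s Y))),
    [/\ cls J f0 = f, cls J g0 = g, i0 ∘ s_in (s X) = s_in (s Y) ∘ f0
      & g0 ∘ s_out (s X) = s_out (s Y) ∘ i0].

(* A conflation X -u-> Y -v-> Z and a morphism from it to X -> I -> S X which is
   the identity on X, with last component w : Z -> S X, give the standard
   triangle (u, v, -w). *)
Definition standard_triangle (X Y Z : E) (u : @hom Q X Y) (v : @hom Q Y Z)
    (w : @hom Q Z (sS (s X))) :=
  exists (u0 : hom X Y) (v0 : hom Y Z) (i0 : hom Y (sI (s X)))
         (w0 : hom Z (sS (s X))),
    [/\ conf u0 v0, i0 ∘ u0 = s_in (s X), w0 ∘ v0 = s_out (s X) ∘ i0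
      & [/\ u = cls J u0, v = cls J v0 & w = cls J (- w0)]].

Definition distinguished (X Y Z : E) (u : @hom Q X Y) (v : @hom Q Y Z)
    (w : @hom Q Z (sS (s X))) :=
  exists (X' Y' Z' : E) (u' : @hom Q X' Y') (v' : @hom Q Y' Z')
         (w' : @hom Q Z' (sS (s X')))
         (a : @hom Q X X') (b : @hom Q Y Y') (c : @hom Q Z Z')
         (Sa : @hom Q (sS (s X)) (sS (s X'))),
    [/\ standard_triangle u' v' w', is_iso a, is_iso b, is_iso c
      & [/\ susp_map a Sa, b ∘ u = u' ∘ a, c ∘ v = v' ∘ b & Sa ∘ w = w' ∘ c]].

End Triangles.

Definition triangulated_functor (E1 E2 : excat) (J1 : ideal E1) (J2 : ideal E2)
    (F : functor (quotient J1) (quotient J2)) :=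
  additive_functor F /\
  forall (s1 : forall X : E1, suspension X) (s2 : forall X : E2, suspension X),
  exists phi : forall X : E1, @hom (quotient J2) (F (sS (s1 X))) (sS (s2 (F X))),
    [/\ forall X, is_iso (phi X),
        forall (X Y : E1) (f : @hom (quotient J1) X Y)
            (g : @hom (quotient J1) (sS (s1 X)) (sS (s1 Y)))
            (g' : @hom (quotient J2) (sS (s2 (F X))) (sS (s2 (F Y)))),
          susp_map f g -> susp_map (fmap F f) g' ->
          g' ∘ phi X = phi Y ∘ fmap F g
      & forall (X Y Z : E1) (u : @hom (quotient J1) X Y)
            (v : @hom (quotient J1) Y Z)
            (w : @hom (quotient J1) Z (sS (s1 X))),
          distinguished u v w ->
          @distinguished E2 J2 s2 (F X) (F Y) (F Z)
            (fmap F u) (fmap F v) (phi X ∘ fmap F w)].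

Section AbelianExact.
Variable A : abcat.

Definition short_exact (X Y Z : A) (i : hom X Y) (p : hom Y Z) :=
  is_kernel p i /\ is_cokernel i p.

Definition split_exact (X Y Z : A) (i : hom X Y) (p : hom Y Z) :=
  short_exact i p /\ exists t : hom Z Y, p ∘ t = idm Z.

Definition ab_excat : excat := @Excat A short_exact.

End AbelianExact.

(* n + r, as an iterated successor, so that iterated differentials typecheck *)
Definition shift (n : int) (r : nat) : int := iter r (fun k => k + 1) n.

Lemma shiftE n r : shift n r = n + r%:Z.
Proof. by elim: r => [|r /= ->]; rewrite /shift /= ?addr0 // -addrA -PoszD addn1. Qed.

Section IteratedDifferential.
Variables (A : preadd) (X : int -> A) (d : forall n, hom (X n) (X (n + 1))).

Fixpoint diter (n : int) (r : nat) : hom (X n) (X (shift n r)) :=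
  if r is r'.+1 then d (shift n r') ∘ diter n r' else idm (X n).

(* d^{m,r} with its target X^{m+r} rewritten as X^n *)
Definition diter_to (m : int) (r : nat) (n : int) (e : shift m r = n) :
    hom (X m) (X n) :=
  ecast k (hom (X m) (X k)) e (diter m r).

Lemma diter_toS m r n (e : shift m r = n) (e' : shift m r.+1 = n + 1) :
  d n ∘ diter_to e = diter_to e'.
Proof. by case: _ / e e' => e'; rewrite (eq_irrelevance e' erefl). Qed.

Lemma diter_to_comp m r n s p (e1 : shift m r = n) (e2 : shift n s = p)
    (e3 : shift m (s + r) = p) :
  diter_to e2 ∘ diter_to e1 = diter_to e3.
Proof.
case: _ / e1 e2 e3 => e2; case: _ / e2 => /=.
elim: s => [|s IHs] e3; first by rewrite /= comp1m (eq_irrelevance e3 erefl).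
have e : shift m (s + r) = shift (shift m r) s by rewrite /shift iterD.
by rewrite -(diter_toS e) -IHs compA.
Qed.

End IteratedDifferential.

Section NComplexes.
Variables (A : abcat) (N : nat).

Record ncomplex := NComplex {
  cob :> int -> A;
  cd : forall n, hom (cob n) (cob (n + 1));
  cdN : forall n, diter cd n N = 0 }.

Record cmor (X Y : ncomplex) := Cmor {
  cmap :> forall n, hom (X n) (Y n);
  cmapP : forall n, cd Y n ∘ cmap n = cmap (n + 1) ∘ cd X n }.

Lemma cmor_eq (X Y : ncomplex) (f g : cmor X Y) : (forall n, f n = g n) -> f = g.
Proof.
case: f g => [f fP] [g gP] /= fg.
have {}fg : f = g by exact: functional_extensionality_dep.
by case: _ / fg gP => gP; congr Cmor; exact: Prop_irrelevance.
Qed.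

Section CmorZmod.
Variables X Y : ncomplex.

Fact cmor0P n : cd Y n ∘ 0 = 0 ∘ cd X n.
Proof. by rewrite comp0m compm0. Qed.
Fact cmorNP (f : cmor X Y) n : cd Y n ∘ (- f n) = (- f (n + 1)) ∘ cd X n.
Proof. by rewrite compNl compNr cmapP. Qed.
Fact cmorDP (f g : cmor X Y) n :
  cd Y n ∘ (f n + g n) = (f (n + 1) + g (n + 1)) ∘ cd X n.
Proof. by rewrite compDl compDr !cmapP. Qed.

Definition cmor0 : cmor X Y := @Cmor X Y (fun=> 0) cmor0P.
Definition cmorN (f : cmor X Y) : cmor X Y :=
  @Cmor X Y (fun n => - f n) (cmorNP f).
Definition cmorD (f g : cmor X Y) : cmor X Y :=
  @Cmor X Y (fun n => f n + g n) (cmorDP f g).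

HB.instance Definition _ := gen_eqMixin (cmor X Y).
HB.instance Definition _ := gen_choiceMixin (cmor X Y).

Fact cmorDA : associative cmorD.
Proof. by move=> f g h; apply: cmor_eq => n /=; rewrite addrA. Qed.
Fact cmorDC : commutative cmorD.
Proof. by move=> f g; apply: cmor_eq => n /=; rewrite addrC. Qed.
Fact cmorD0 : left_id cmor0 cmorD.
Proof. by move=> f; apply: cmor_eq => n /=; rewrite add0r. Qed.
Fact cmorDN : left_inverse cmor0 cmorN cmorD.
Proof. by move=> f; apply: cmor_eq => n /=; rewrite addNr. Qed.

HB.instance Definition _ :=
  GRing.isZmodule.Build (cmor X Y) cmorDA cmorDC cmorD0 cmorDN.

End CmorZmod.

Fact cmor1P (X : ncomplex) n : cd X n ∘ idm (X n) = idm (X (n + 1)) ∘ cd X n.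
Proof. by rewrite comp1m compm1. Qed.
Definition cmor1 (X : ncomplex) : cmor X X :=
  @Cmor X X (fun n => idm (X n)) (@cmor1P X).

Fact cmorMP (X Y Z : ncomplex) (g : cmor Y Z) (f : cmor X Y) n :
  cd Z n ∘ (g n ∘ f n) = (g (n + 1) ∘ f (n + 1)) ∘ cd X n.
Proof. by rewrite compA cmapP -!compA cmapP. Qed.
Definition cmorM (X Y Z : ncomplex) (g : cmor Y Z) (f : cmor X Y) : cmor X Z :=
  @Cmor X Z (fun n => g n ∘ f n) (cmorMP g f).

Fact cmor1M X Y (f : cmor X Y) : cmorM (cmor1 Y) f = f.
Proof. by apply: cmor_eq => n /=; rewrite comp1m. Qed.
Fact cmorM1 X Y (f : cmor X Y) : cmorM f (cmor1 X) = f.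
Proof. by apply: cmor_eq => n /=; rewrite compm1. Qed.
Fact cmorMA X Y Z W (h : cmor Z W) (g : cmor Y Z) (f : cmor X Y) :
  cmorM h (cmorM g f) = cmorM (cmorM h g) f.
Proof. by apply: cmor_eq => n /=; rewrite compA. Qed.
Fact cmorMDl X Y Z (g g' : cmor Y Z) (f : cmor X Y) :
  cmorM (g + g') f = cmorM g f + cmorM g' f.
Proof. by apply: cmor_eq => n /=; rewrite compDl. Qed.
Fact cmorMDr X Y Z (g : cmor Y Z) (f f' : cmor X Y) :
  cmorM g (f + f') = cmorM g f + cmorM g f'.
Proof. by apply: cmor_eq => n /=; rewrite compDr. Qed.

Definition CN : preadd :=
  @Preadd ncomplex (fun X Y => cmor X Y) cmor1 cmorM
    cmor1M cmorM1 cmorMA cmorMDl cmorMDr.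

Lemma cmap_diter (X Y : ncomplex) (f : cmor X Y) n r :
  diter (cd Y) n r ∘ f n = f (shift n r) ∘ diter (cd X) n r.
Proof.
elim: r => [|r IHr] /=; first by rewrite comp1m compm1.
by rewrite -compA IHr !compA; congr (_ ∘ _); rewrite cmapP.
Qed.

Lemma cmap_diter_to (X Y : ncomplex) (f : cmor X Y) m r n (e : shift m r = n) :
  diter_to (cd Y) e ∘ f m = f n ∘ diter_to (cd X) e.
Proof. by case: _ / e; exact: cmap_diter. Qed.

Fact htp_index (i : int) (k : nat) :
  (k < N)%N -> shift (shift i k - N%:Z + 1) (N - k.+1) = i.
Proof. by rewrite !shiftE; lia. Qed.

(* The summand of index k is d_Y^{i+j-N,N-j} h^{i+j-1} d_X^{i,j-1} for j = k+1. *)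
Definition null_homotopic (X Y : ncomplex) (f : cmor X Y) :=
  exists h : forall i : int, hom (X i) (Y (i - N%:Z + 1)),
    forall i : int, f i =
      \sum_(k < N) diter_to (cd Y) (htp_index i (ltn_ord k))
                   ∘ h (shift i k) ∘ diter (cd X) i k.

Fact null_homotopic0 X Y : null_homotopic (0 : cmor X Y).
Proof.
by exists (fun=> 0) => i /=; rewrite big1 // => k _; rewrite compm0 comp0m.
Qed.

Fact null_homotopicB X Y (f g : cmor X Y) :
  null_homotopic f -> null_homotopic g -> null_homotopic (f - g).
Proof.
move=> [h hP] [h' hP']; exists (fun i => h i - h' i) => i /=.
by rewrite hP hP' -sumrB; apply: eq_bigr => k _; rewrite compBr compBl.
Qed.

Fact null_homotopicL X Y Z (g : cmor Y Z) (f : cmor X Y) :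
  null_homotopic f -> null_homotopic (cmorM g f).
Proof.
move=> [h hP]; exists (fun i => g _ ∘ h i) => i /=; rewrite hP comp_sumr.
by apply: eq_bigr => k _; rewrite !compA cmap_diter_to.
Qed.

Fact null_homotopicR X Y Z (g : cmor Y Z) (f : cmor X Y) :
  null_homotopic g -> null_homotopic (cmorM g f).
Proof.
move=> [h hP]; exists (fun i => h i ∘ f i) => i /=; rewrite hP comp_suml.
by apply: eq_bigr => k _; rewrite -!compA cmap_diter.
Qed.

Definition htp_ideal : ideal CN :=
  @Ideal CN null_homotopic null_homotopic0 null_homotopicB
    null_homotopicL null_homotopicR.

Definition KN : preadd := quotient htp_ideal.

Definition Zob (X : ncomplex) (n : int) (r : nat) : A := Ker (diter (cd X) n r).
Definition Zin (X : ncomplex) (n : int) (r : nat) : hom (Zob X n r) (X n) :=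
  ker (diter (cd X) n r).

Fact bnd_index (n : int) (r : nat) :
  (0 < r < N)%N -> shift (n - N%:Z + r%:Z) (N - r) = n.
Proof. by rewrite shiftE; lia. Qed.

(* d^{n-N+r,N-r} : X^{n-N+r} -> X^n, whose image is B^n_r *)
Definition bnd (X : ncomplex) (n : int) (r : nat) (hr : (0 < r < N)%N) :
  hom (X (n - N%:Z + r%:Z)) (X n) := diter_to (cd X) (bnd_index n hr).

Fact diter_bnd (X : ncomplex) (n : int) (r : nat) (hr : (0 < r < N)%N) :
  diter (cd X) n r ∘ bnd X n hr = 0.
Proof.
have eN : (r + (N - r) = N)%N by lia.
have e : shift (n - N%:Z + r%:Z) (r + (N - r)) = shift n r.
  by rewrite !shiftE; lia.
rewrite -[diter _ n r]/(diter_to (cd X) erefl) (diter_to_comp _ _ _ e).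
by case: _ / e; rewrite /diter_to /= eN cdN.
Qed.

(* H^n_r = Z^n_r / B^n_r *)
Definition Hob (X : ncomplex) (n : int) (r : nat) (hr : (0 < r < N)%N) : A :=
  homology (diter_bnd X n hr).

Definition acyclic (X : ncomplex) :=
  forall (n : int) (r : nat) (hr : (0 < r < N)%N), is_zero (Hob X n hr).

Definition ac_proj (X : CN) :=
  acyclic X /\ forall n : int, @projective (ab_excat A) (X n).

(* C_N^ac(Proj A), with the chainwise split exact sequences *)
Definition CNacP : excat :=
  @Excat (full_sub ac_proj) (fun X Y Z i p =>
    forall n : int, split_exact (cmap i n) (cmap p n)).

Definition htp_ideal_acP : ideal CNacP :=
  @Ideal CNacP (fun X Y f => null_homotopic f)
    (fun _ _ => null_homotopic0 _ _) (fun _ _ => @null_homotopicB _ _)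
    (fun _ _ _ => @null_homotopicL _ _ _) (fun _ _ _ => @null_homotopicR _ _ _).

Definition KNacP : preadd := quotient htp_ideal_acP.

(* KNacP is the full subcategory of KN on the objects satisfying ac_proj. *)
Fact KNacP_ob : ob KNacP = ob (@full_sub KN ac_proj).
Proof. by []. Qed.
Fact KNacP_hom : @hom KNacP = @hom (@full_sub KN ac_proj).
Proof. by []. Qed.
Fact KNacP_idm : @idm KNacP = @idm (@full_sub KN ac_proj).
Proof. by []. Qed.
Fact KNacP_comp : @comp KNacP = @comp (@full_sub KN ac_proj).
Proof. by []. Qed.

End NComplexes.

Section MonoChains.
Variables (A : abcat) (m : nat).

Local Notation src i := (widen_ord (leqnSn m) i).
Local Notation tgt i := (lift ord0 i).

(* MMor_m(A): chains X_0 -> ... -> X_m of m monomorphisms; the i-th one goes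
   from X_i to X_{i+1}. *)
Record mchain := MChain {
  mob :> 'I_m.+1 -> A;
  marr : forall i : 'I_m, hom (mob (src i)) (mob (tgt i));
  marr_mono : forall i, mono (marr i) }.

Record mmor (X Y : mchain) := Mmor {
  mmap :> forall k, hom (X k) (Y k);
  mmapP : forall i, mmap (tgt i) ∘ marr X i = marr Y i ∘ mmap (src i) }.

Lemma mmor_eq (X Y : mchain) (f g : mmor X Y) : (forall k, f k = g k) -> f = g.
Proof.
case: f g => [f fP] [g gP] /= fg.
have {}fg : f = g by exact: functional_extensionality_dep.
by case: _ / fg gP => gP; congr Mmor; exact: Prop_irrelevance.
Qed.

Section MmorZmod.
Variables X Y : mchain.

Fact mmor0P i : 0 ∘ marr X i = marr Y i ∘ 0.
Proof. by rewrite comp0m compm0. Qed.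
Fact mmorNP (f : mmor X Y) i :
  (- f (tgt i)) ∘ marr X i = marr Y i ∘ (- f (src i)).
Proof. by rewrite compNl compNr mmapP. Qed.
Fact mmorDP (f g : mmor X Y) i :
  (f (tgt i) + g (tgt i)) ∘ marr X i = marr Y i ∘ (f (src i) + g (src i)).
Proof. by rewrite compDl compDr !mmapP. Qed.

Definition mmor0 : mmor X Y := @Mmor X Y (fun=> 0) mmor0P.
Definition mmorN (f : mmor X Y) : mmor X Y :=
  @Mmor X Y (fun k => - f k) (mmorNP f).
Definition mmorD (f g : mmor X Y) : mmor X Y :=
  @Mmor X Y (fun k => f k + g k) (mmorDP f g).

HB.instance Definition _ := gen_eqMixin (mmor X Y).
HB.instance Definition _ := gen_choiceMixin (mmor X Y).

Fact mmorDA : associative mmorD.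
Proof. by move=> f g h; apply: mmor_eq => k /=; rewrite addrA. Qed.
Fact mmorDC : commutative mmorD.
Proof. by move=> f g; apply: mmor_eq => k /=; rewrite addrC. Qed.
Fact mmorD0 : left_id mmor0 mmorD.
Proof. by move=> f; apply: mmor_eq => k /=; rewrite add0r. Qed.
Fact mmorDN : left_inverse mmor0 mmorN mmorD.
Proof. by move=> f; apply: mmor_eq => k /=; rewrite addNr. Qed.

HB.instance Definition _ :=
  GRing.isZmodule.Build (mmor X Y) mmorDA mmorDC mmorD0 mmorDN.

End MmorZmod.

Fact mmor1P (X : mchain) i : idm (X (tgt i)) ∘ marr X i = marr X i ∘ idm (X (src i)).
Proof. by rewrite comp1m compm1. Qed.
Definition mmor1 (X : mchain) : mmor X X :=
  @Mmor X X (fun k => idm (X k)) (@mmor1P X).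

Fact mmorMP (X Y Z : mchain) (g : mmor Y Z) (f : mmor X Y) i :
  (g (tgt i) ∘ f (tgt i)) ∘ marr X i = marr Z i ∘ (g (src i) ∘ f (src i)).
Proof. by rewrite -compA mmapP !compA mmapP. Qed.
Definition mmorM (X Y Z : mchain) (g : mmor Y Z) (f : mmor X Y) : mmor X Z :=
  @Mmor X Z (fun k => g k ∘ f k) (mmorMP g f).

Fact mmor1M X Y (f : mmor X Y) : mmorM (mmor1 Y) f = f.
Proof. by apply: mmor_eq => k /=; rewrite comp1m. Qed.
Fact mmorM1 X Y (f : mmor X Y) : mmorM f (mmor1 X) = f.
Proof. by apply: mmor_eq => k /=; rewrite compm1. Qed.
Fact mmorMA X Y Z W (h : mmor Z W) (g : mmor Y Z) (f : mmor X Y) :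
  mmorM h (mmorM g f) = mmorM (mmorM h g) f.
Proof. by apply: mmor_eq => k /=; rewrite compA. Qed.
Fact mmorMDl X Y Z (g g' : mmor Y Z) (f : mmor X Y) :
  mmorM (g + g') f = mmorM g f + mmorM g' f.
Proof. by apply: mmor_eq => k /=; rewrite compDl. Qed.
Fact mmorMDr X Y Z (g : mmor Y Z) (f f' : mmor X Y) :
  mmorM g (f + f') = mmorM g f + mmorM g f'.
Proof. by apply: mmor_eq => k /=; rewrite compDr. Qed.

Definition MMor : excat :=
  @Excat (@Preadd mchain (fun X Y => mmor X Y) mmor1 mmorM
            mmor1M mmorM1 mmorMA mmorMDl mmorMDr)
    (fun X Y Z i p => forall k, short_exact (mmap i k) (mmap p k)).

Fact MMor_has_zero : exists Z : MMor, is_zero Z.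
Proof.
case: (abcatP A) => [[[O [O1 O2]] _] _ _ _ _].
have mO (i : 'I_m) : mono (0 : hom O O).
  by move=> W u v _; rewrite (O1 _ u) (O1 _ v).
exists (@MChain (fun=> O) (fun=> 0) mO); split=> X f; apply: mmor_eq => k /=.
- exact: O1.
- exact: O2.
Qed.

Record biprod_data (X Y : A) := BiprodData {
  bS : A; b1 : hom X bS; b2 : hom Y bS; q1 : hom bS X; q2 : hom bS Y;
  bP : is_biproduct b1 b2 q1 q2 }.

Fact biprod_exists (X Y : A) : exists _ : biprod_data X Y, True.
Proof.
have [[_ bip] _ _ _ _] := abcatP A.
by have [S [i1 [i2 [p1 [p2 h]]]]] := bip X Y; exists (BiprodData h).
Qed.

Fact MMor_has_biproducts (X Y : MMor) :
  exists (S : MMor) (i1 : hom X S) (i2 : hom Y S) (p1 : hom S X) (p2 : hom S Y),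
    is_biproduct i1 i2 p1 p2.
Proof.
pose b k : biprod_data (mob X k) (mob Y k) := sval (cid (biprod_exists _ _)).
pose a (i : 'I_m) : hom (bS (b (src i))) (bS (b (tgt i))) :=
  b1 (b (tgt i)) ∘ (marr X i ∘ q1 (b (src i)))
  + b2 (b (tgt i)) ∘ (marr Y i ∘ q2 (b (src i))).
have q1a i : q1 (b (tgt i)) ∘ a i = marr X i ∘ q1 (b (src i)).
  have [e1 e2 e12 e21 e] := bP (b (tgt i)).
  by rewrite compDr !(compA (q1 (b (tgt i)))) e1 e12 comp1m comp0m addr0.
have q2a i : q2 (b (tgt i)) ∘ a i = marr Y i ∘ q2 (b (src i)).
  have [e1 e2 e12 e21 e] := bP (b (tgt i)).
  by rewrite compDr !(compA (q2 (b (tgt i)))) e2 e21 comp1m comp0m add0r.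
have ab1 i : a i ∘ b1 (b (src i)) = b1 (b (tgt i)) ∘ marr X i.
  have [e1 e2 e12 e21 e] := bP (b (src i)).
  by rewrite compDl -!compA e1 e21 !compm0 compm1 addr0.
have ab2 i : a i ∘ b2 (b (src i)) = b2 (b (tgt i)) ∘ marr Y i.
  have [e1 e2 e12 e21 e] := bP (b (src i)).
  by rewrite compDl -!compA e2 e12 !compm0 compm1 add0r.
have ma i : mono (a i).
  move=> W u v uv; have [_ _ _ _ e] := bP (b (src i)).
  have e1 : q1 (b (src i)) ∘ u = q1 (b (src i)) ∘ v.
    by apply: (@marr_mono X i); rewrite !compA -q1a -!compA uv.
  have e2 : q2 (b (src i)) ∘ u = q2 (b (src i)) ∘ v.
    by apply: (@marr_mono Y i); rewrite !compA -q2a -!compA uv.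
  by rewrite -(comp1m u) -(comp1m v) -e !compDl -!compA e1 e2.
pose S : MMor := @MChain (fun k => bS (b k)) a ma.
exists S, (@Mmor X S (fun k => b1 (b k)) (fun i => esym (ab1 i))).
exists (@Mmor Y S (fun k => b2 (b k)) (fun i => esym (ab2 i))).
exists (@Mmor S X (fun k => q1 (b k)) q1a), (@Mmor S Y (fun k => q2 (b k)) q2a).
by split; apply: mmor_eq => k /=; case: (bP (b k)).
Qed.

Definition MMor_additive : additive MMor :=
  conj MMor_has_zero MMor_has_biproducts.

Definition stab_ideal : ideal MMor := stable_ideal MMor_additive.

(* stab_N(A) for m = N - 2 *)
Definition stab : preadd := quotient stab_ideal.

End MonoChains.

Section FunctorF.
Variables (A : abcat) (N : nat).

Fact Zincl_proof (X : ncomplex A N) (n : int) (r : nat) :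
  diter (cd X) n r.+1 ∘ Zin X n r = 0.
Proof. by rewrite /= -compA (kerP _).1 compm0. Qed.

(* the canonical inclusion Z^n_r -> Z^n_{r+1} *)
Definition Zincl (X : ncomplex A N) (n : int) (r : nat) :
  hom (Zob X n r) (Zob X n r.+1) := klift (Zincl_proof X n r).

Lemma ZinclE (X : ncomplex A N) (n : int) (r : nat) :
  Zin X n r.+1 ∘ Zincl X n r = Zin X n r.
Proof. exact: kliftE. Qed.

Lemma Zin_mono (X : ncomplex A N) (n : int) (r : nat) : mono (Zin X n r).
Proof. exact: ker_mono. Qed.

Fact Zincl_mono (X : ncomplex A N) (n : int) (r : nat) : mono (Zincl X n r).
Proof.
by move=> W u v uv; apply: Zin_mono; rewrite -(ZinclE X n r) -!compA uv.
Qed.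

Fact Zmap_proof (X Y : ncomplex A N) (f : cmor X Y) (n : int) (r : nat) :
  diter (cd Y) n r ∘ (f n ∘ Zin X n r) = 0.
Proof. by rewrite compA cmap_diter -compA (kerP _).1 compm0. Qed.

(* the restriction Z^n_r(X) -> Z^n_r(Y) of f^n *)
Definition Zmap (X Y : ncomplex A N) (f : cmor X Y) (n : int) (r : nat) :
  hom (Zob X n r) (Zob Y n r) := klift (Zmap_proof f n r).

Lemma ZmapE (X Y : ncomplex A N) (f : cmor X Y) (n : int) (r : nat) :
  Zin Y n r ∘ Zmap f n r = f n ∘ Zin X n r.
Proof. exact: kliftE. Qed.

(* Z^0_1 -> ... -> Z^0_{N-1}; the entry of index k : 'I_(N-1) is Z^0_{k+1} *)
Definition F_ob (X : CNacP A N) : MMor A N.-2 :=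
  @MChain A N.-2 (fun k => Zob (sval X) 0 k.+1)
    (fun i => Zincl (sval X) 0 i.+1) (fun i => @Zincl_mono (sval X) 0 i.+1).

Fact F_mapP (X Y : CNacP A N) (f : hom X Y) (i : 'I_(N.-2)) :
  Zmap f 0 (lift ord0 i).+1 ∘ marr (F_ob X) i
  = marr (F_ob Y) i ∘ Zmap f 0 (widen_ord (leqnSn _) i).+1.
Proof.
apply: Zin_mono; rewrite compA ZmapE -compA [X in _ ∘ X = _]ZinclE.
by rewrite compA [X in _ = X ∘ _]ZinclE ZmapE.
Qed.

Definition F_map (X Y : CNacP A N) (f : hom X Y) : hom (F_ob X) (F_ob Y) :=
  @Mmor A N.-2 (F_ob X) (F_ob Y) (fun k => Zmap f 0 k.+1) (F_mapP f).

Fact F_map1 (X : CNacP A N) : F_map (idm X) = idm (F_ob X).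
Proof.
apply: mmor_eq => k; apply: Zin_mono.
by rewrite [LHS]ZmapE /= comp1m compm1.
Qed.

Fact F_mapM (X Y Z : CNacP A N) (g : hom Y Z) (f : hom X Y) :
  F_map (g ∘ f) = F_map g ∘ F_map f.
Proof.
apply: mmor_eq => k; apply: Zin_mono.
rewrite [LHS]ZmapE [RHS]compA [X in _ = X ∘ _]ZmapE.
by rewrite -[RHS]compA [X in _ = _ ∘ X]ZmapE [RHS]compA.
Qed.

Definition F : functor (CNacP A N) (MMor A N.-2) :=
  @Functor (CNacP A N) (MMor A N.-2) F_ob F_map F_map1 F_mapM.

End FunctorF.

(* Main.v *)
From mathcomp Require Import all_boot all_order all_algebra.
From mathcomp Require Import boolp.
From mathcomp Require Import zify.
Require Import Defs.

(** Since the abelian category has enough projectives, maps from projective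
    objects serve as elements: exactness can be checked on them, and a map from
    a projective object lifts along any map whose image contains its image
    ([proj_lift]).  Since projective objects are injective, dually a map to one
    of them extends along any map whose kernel it kills ([inj_ext],
    [inj_el_ext]).  For an acyclic complex of projectives these two statements
    let data given in degree 0 be propagated upwards by extension and downwards
    by lifting; [int_dep_choice] assembles the steps.  This is used three times.

    - Fullness ([F_full]).  A morphism of chains of cycles extends to a map
      [X^0 -> Y^0] that preserves cycles, and a map in one degree that preserves
      cycles induces one in each of the two neighbouring degrees.

    - Homotopies ([null_homotopic_from0]).  A homotopy formula in degree 0
      propagates to all degrees.  In particular [f] is null-homotopic when
      [F f = 0]: then [f^0] kills the cycles [Z^0_(N-1)], so it factors through
      [d^(N-1)], which is a homotopy formula with a single term
      ([F_map0_null_homotopic]).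

    - Density ([F_dense]).  A chain embedded in a projective object [Q] is
      a filtration [0 = S_0 <= S_1 <= ... <= S_N = Q].  The next degree is an
      embedding of [Q / S_1] in a projective object [Q'], filtered by the
      [S_(r+1) / S_1] for [r < N] and by [Q'] itself; the previous one is
      a projective object that maps onto [S_(N-1)], filtered by the preimages of
      the [S_r].  The resulting complex is acyclic and its cycles in degree 0 are
      the given chain, up to isomorphism.

    The link with factorizations through projective-injective objects is the
    contractible complex [I X] with [I X^i] the direct sum of the [X^m] for
    [i <= m < i + N], whose differential forgets the first summand.  The complex
    [X] embeds in it by a chainwise split conflation, and a null-homotopic map
    from [X] factors through it; [F (I X)] has projective entries, hence is
    projective-injective ([MMor_projinj]: lifts and extensions are built entry
    by entry, the former with the help of a splitting of each monomorphism of
    the chain).  So [F] sends null-homotopic maps to maps that factor through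
    a projective-injective chain ([F_respects]).  Conversely, [F] is exact ([F_exact]), so if [F f] factors
    through an injective chain it factors through [F X -> F (I X)]; by fullness
    [F f = F (b u)] with [u : X -> I X], hence [f - b u] is null-homotopic, and
    so is [b u] because [I X] is contractible ([F_reflects_null_homotopic]).

    Finally [F] preserves conflations and, because a projective-injective
    complex is a retract of its contractible complex, projective-injective
    objects ([F_projinj]); an additive functor with these two properties induces
    a triangulated functor ([induced_triangulated]). *)

Set Implicit Arguments.
Unset Strict Implicit.
Unset Printing Implicit Defensive.

Import Order.TTheory GRing.Theory.
Local Open Scope ring_scope.

(** * Kernels, cokernels and images in an abelian category *)

Section AbelianLemmas.
Variable A : abcat.

Lemma kernel_mono (X Y K : A) (f : hom X Y) (k : hom K X) :
  is_kernel f k -> mono k.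
Proof.
move=> [fk kP] W u v uv; have [|w [_ wP]] := kP W (k ∘ u).
  by rewrite compA fk comp0m.
by rewrite -(wP u erefl) (wP v).
Qed.

Lemma cokernel_epi (X Y Q : A) (f : hom X Y) (q : hom Y Q) :
  is_cokernel f q -> epi q.
Proof.
move=> [qf qP] W u v uv; have [|w [_ wP]] := qP W (u ∘ q).
  by rewrite -compA qf compm0.
by rewrite -(wP u erefl) (wP v).
Qed.

Lemma epi0 (X Y : A) (f : hom X Y) :
  (forall (W : A) (w : hom Y W), w ∘ f = 0 -> w = 0) -> epi f.
Proof.
move=> f0 W u v uv; apply/eqP; rewrite -subr_eq0; apply/eqP/f0.
by rewrite compBl uv subrr.
Qed.

Lemma mono_eq0 (X Y W : A) (f : hom X Y) (w : hom W X) :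
  mono f -> f ∘ w = 0 -> w = 0.
Proof. by move=> fm fw; apply: fm; rewrite fw compm0. Qed.

Lemma epi_eq0 (X Y W : A) (f : hom X Y) (w : hom Y W) :
  epi f -> w ∘ f = 0 -> w = 0.
Proof. by move=> fe wf; apply: fe; rewrite wf comp0m. Qed.

Lemma mono_kernel_coker (X Y : A) (m : hom X Y) :
  mono m -> is_kernel (coker m) m.
Proof.
move=> mm; split; first exact: (cokerP m).1.
move=> W g cg; have [_ _ _ + _] := abcatP A => /(_ _ _ _ mm) [Z [f [fm fP]]].
have [u [uE _]] := (cokerP m).2 _ _ fm.
by apply: fP; rewrite -uE -compA cg compm0.
Qed.

Lemma epi_cokernel (X Y K : A) (k : hom K X) (e : hom X Y) :
  epi e -> is_kernel e k -> is_cokernel k e.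
Proof.
move=> ee [ek kP]; split=> // W g gk.
have [_ _ _ _ /(_ _ _ _ ee) [Z [f [ef fP]]]] := abcatP A.
have [u [uE _]] := kP _ _ ef.
by apply: fP; rewrite -uE compA gk comp0m.
Qed.

Lemma mono_short_exact (X Y : A) (m : hom X Y) :
  mono m -> short_exact m (coker m).
Proof. by move=> mm; split; [exact: mono_kernel_coker | exact: cokerP]. Qed.

Lemma epi_short_exact (X Y : A) (e : hom X Y) :
  epi e -> short_exact (ker e) e.
Proof. by move=> ee; split; [exact: kerP | apply: epi_cokernel; [|exact: kerP]]. Qed.

Lemma image_factorization (X Y : A) (f : hom X Y) :
  exists (I : A) (e : hom X I) (m : hom I Y),
    [/\ epi e, is_kernel (coker f) m & m ∘ e = f].
Proof.
have [m mP] : exists m : hom (Im f) Y, is_kernel (coker f) m.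
  by exists (im f); exact: kerP.
have mm := kernel_mono mP.
have [e [eE _]] := mP.2 _ _ (cokerP f).1.
exists (Im f), e, m; split=> //; apply: epi0 => W u ue.
have [e' [e'E _]] := (kerP u).2 _ _ ue.
(* the subobject m ∘ ker u contains the image of f, so it is all of m *)
have km : mono (m ∘ ker u).
  by move=> V a b; rewrite -!compA => /mm /ker_mono.
have [ik0 ikP] := mono_kernel_coker km.
have gf0 : coker (m ∘ ker u) ∘ (m ∘ e) = 0.
  by rewrite -e'E (compA m) compA ik0 comp0m.
rewrite eE in gf0.
have [g' [gE _]] := (cokerP f).2 _ _ gf0.
have gi0 : coker (m ∘ ker u) ∘ m = 0 by rewrite -gE -compA mP.1 compm0.
have [t [tE _]] := ikP _ _ gi0.
have kt : ker u ∘ t = idm _ by apply: mm; rewrite compA tE compm1.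
by rewrite -(compm1 u) -kt compA (kerP u).1 comp0m.
Qed.

Local Notation proj P := (@projective (ab_excat A) P).
Local Notation inj I := (@injective (ab_excat A) I).

Lemma proj_epi_lift (P X Y : A) (e : hom X Y) (u : hom P Y) :
  proj P -> epi e -> exists v, e ∘ v = u.
Proof. by move=> pP ee; apply: (pP _ _ _ _ _ (epi_short_exact ee)). Qed.

Lemma inj_mono_ext (I X Y : A) (m : hom X Y) (u : hom X I) :
  inj I -> mono m -> exists v, v ∘ m = u.
Proof. by move=> iI mm; apply: (iI _ _ _ _ _ (mono_short_exact mm)). Qed.

(** A map from a projective lifts along any map whose image contains its own. *)
Lemma proj_lift (P X Y : A) (g : hom X Y) (u : hom P Y) :
  proj P -> coker g ∘ u = 0 -> exists v, g ∘ v = u.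
Proof.
move=> pP cu; have [I [e [m [ee mP gE]]]] := image_factorization g.
have [u' [u'E _]] := mP.2 _ _ cu; have [v vE] := proj_epi_lift u' pP ee.
by exists v; rewrite -gE -compA vE.
Qed.

(** A map to an injective extends along any map whose kernel it kills. *)
Lemma inj_ext (I X Y : A) (f : hom X Y) (u : hom X I) :
  inj I -> u ∘ ker f = 0 -> exists v, v ∘ f = u.
Proof.
move=> iI uk; have [J [e [m [ee /kernel_mono mm fE]]]] := image_factorization f.
have fk0 : f ∘ ker e = 0 by rewrite -fE -compA (kerP e).1 compm0.
have uk0 : u ∘ ker e = 0 by rewrite -(kliftE fk0) compA uk comp0m.
have [u' [u'E _]] := (epi_short_exact ee).2.2 _ _ uk0.
have [v vE] := inj_mono_ext u' iI mm.
by exists v; rewrite -fE compA vE.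
Qed.

Lemma proj_retract (P Q : A) (s : hom P Q) (r : hom Q P) :
  r ∘ s = idm P -> proj Q -> proj P.
Proof.
move=> rs pQ X Y Z i p ip f; have [g gE] := pQ _ _ _ _ _ ip (f ∘ r).
by exists (g ∘ s); rewrite compA gE -compA rs compm1.
Qed.

Lemma is_zero_id (Z : A) : idm Z = 0 -> is_zero Z.
Proof.
by move=> z; split=> X f; rewrite -1?[f]comp1m -1?[f]compm1 z ?comp0m ?compm0.
Qed.

(** The biproduct of the [Y m] for [m \in s], with injections and projections for
    every index [m]; the projections are zero for [m \notin s]. *)
Lemma finite_biproduct (I : eqType) (Y : I -> A) (s : seq I) : uniq s ->
  exists (S : A) (i : forall m, hom (Y m) S) (p : forall m, hom S (Y m)),
    [/\ forall m, m \in s -> p m ∘ i m = idm (Y m),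
        forall m n, m != n -> p m ∘ i n = 0,
        forall m, m \notin s -> p m = 0
      & \sum_(m <- s) i m ∘ p m = idm S].
Proof.
have [[[Z [Z1 Z2]] bip] _ _ _ _] := abcatP A.
elim: s => [_|a s IHs /= /andP [as_ us]].
  exists Z, (fun=> 0), (fun=> 0); split=> //.
  - by move=> m n _; rewrite comp0m.
  - by rewrite big_nil (Z1 _ (idm Z)).
have [S [i [p [ii0 ij0 p0 ip1]]]] := IHs us.
have [T [i1 [i2 [p1 [p2 [e11 e22 e12 e21 e]]]]]] := bip S (Y a).
pose i' m : hom (Y m) T := match m =P a with
  | ReflectT ma => i2 ∘ ecast b (hom (Y m) (Y b)) ma (idm _) | _ => i1 ∘ i m end.
pose p' m : hom T (Y m) := match m =P a with
  | ReflectT ma => ecast b (hom (Y b) (Y m)) ma (idm _) ∘ p2 | _ => p m ∘ p1 end.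
have i'a : i' a = i2.
  rewrite /i'; case: eqP => // aa.
  by rewrite (eq_irrelevance aa erefl) /= compm1.
have p'a : p' a = p2.
  rewrite /p'; case: eqP => // aa.
  by rewrite (eq_irrelevance aa erefl) /= comp1m.
have i'n m : m != a -> i' m = i1 ∘ i m by rewrite /i'; case: eqP.
have p'n m : m != a -> p' m = p m ∘ p1 by rewrite /p'; case: eqP.
have ns m : m \in s -> m != a by move=> ms; apply: contraNneq as_ => <-.
exists T, i', p'; split.
- move=> m; rewrite in_cons; have [-> _|ma /= ms] := eqVneq m a.
    by rewrite i'a p'a.
  by rewrite i'n // p'n // compA -(compA (p m)) e11 compm1 ii0.
- move=> m n; have [-> an|ma] := eqVneq m a.
    by rewrite p'a i'n 1?eq_sym // compA e21 comp0m.
  rewrite p'n //; have [->|na] := eqVneq n a => mn.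
    by rewrite i'a -compA e12 compm0.
  by rewrite i'n // compA -(compA (p m)) e11 compm1 ij0.
- move=> m; rewrite in_cons negb_or => /andP [ma ms].
  by rewrite p'n // p0 // comp0m.
- rewrite big_cons i'a p'a addrC -e; congr (_ + _).
  rewrite -[p1]comp1m -ip1 comp_suml comp_sumr !big_seq.
  by apply: eq_bigr => m /ns ma; rewrite i'n // p'n // !compA.
Qed.

Lemma biproduct_proj (I : eqType) (Y : I -> A) (s : seq I) (S : A)
    (i : forall m, hom (Y m) S) (p : forall m, hom S (Y m)) :
  \sum_(m <- s) i m ∘ p m = idm S -> (forall m, proj (Y m)) -> proj S.
Proof.
move=> ip pY X Z W j q jq f.
have lift m : exists g, q ∘ g = f ∘ i m by exact: pY jq _.
exists (\sum_(m <- s) sval (cid (lift m)) ∘ p m).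
rewrite comp_sumr -[RHS]compm1 -ip comp_sumr; apply: eq_bigr => m _.
by rewrite compA (svalP (cid (lift m))) compA.
Qed.

Lemma short_exact_factor (X Y Z W : A) (i : hom X Y) (p : hom Y Z) (w : hom W Y) :
  short_exact i p -> p ∘ w = 0 -> exists v, i ∘ v = w.
Proof. by move=> [[_ iP] _] /iP [v [vE _]]; exists v. Qed.

Lemma short_exact_lift (X Y Z W : A) (i : hom X Y) (p : hom Y Z) (w : hom W Z) :
  short_exact i p -> proj W -> exists v, p ∘ v = w.
Proof. by move=> [_ /cokernel_epi pe] pW; exact: proj_epi_lift. Qed.

End AbelianLemmas.

Section Frobenius.
Variable A : abcat.
Hypothesis hA : frobenius (ab_excat A).

Local Notation proj P := (@projective (ab_excat A) P).
Local Notation inj I := (@injective (ab_excat A) I).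

Lemma proj_inj (P : A) : proj P -> inj P.
Proof. by case: hA => _ _ h /h. Qed.

Lemma inj_proj (P : A) : inj P -> proj P.
Proof. by case: hA => _ _ h /h. Qed.

Lemma proj_cover (X : A) : exists (P : A) (p : hom P X), proj P /\ epi p.
Proof.
case: hA => /(_ X) [K [P [i [p [[_ /cokernel_epi pe] pP]]]]] _ _.
by exists P, p.
Qed.

Lemma proj_embedding (X : A) : exists (Q : A) (q : hom X Q), proj Q /\ mono q.
Proof.
case: hA => _ /(_ X) [I [S [i [p [[/kernel_mono im _] iI]]]]] _.
by exists I, i; split; first exact: inj_proj.
Qed.

(** Maps from projectives serve as elements: by the next lemmas they detect
    equality, factorizations, epimorphisms and kernels. *)
Lemma proj_el_eq (X Y : A) (f g : hom X Y) :
  (forall (W : A) (w : hom W X), proj W -> f ∘ w = g ∘ w) -> f = g.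
Proof. by move=> fg; have [P [p [pP pe]]] := proj_cover X; apply/pe/fg. Qed.

Lemma proj_el_factor (X Y K : A) (k : hom K Y) (f : hom X Y) : mono k ->
  (forall (W : A) (w : hom W X), proj W -> exists v, k ∘ v = f ∘ w) ->
  exists v, k ∘ v = f.
Proof.
move=> km kf; have [ck kP] := mono_kernel_coker km.
have [|v [vE _]] := kP _ f; last by exists v.
apply: proj_el_eq => W w pW; have [v vE] := kf W w pW.
by rewrite comp0m -compA -vE compA ck comp0m.
Qed.

Lemma proj_el_epi (X Y : A) (f : hom X Y) :
  (forall (W : A) (w : hom W Y), proj W -> exists v, f ∘ v = w) -> epi f.
Proof.
move=> fP Z u v uv; apply: proj_el_eq => W w pW; have [t <-] := fP W w pW.
by rewrite !compA uv.
Qed.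

Lemma inj_el_ext (I X Y : A) (f : hom X Y) (u : hom X I) : inj I ->
  (forall (W : A) (w : hom W X), proj W -> f ∘ w = 0 -> u ∘ w = 0) ->
  exists v, v ∘ f = u.
Proof.
move=> iI fu; apply: inj_ext => //; apply: proj_el_eq => W w pW.
by rewrite comp0m -compA fu // compA (kerP f).1 comp0m.
Qed.

Lemma short_exact_el (X Y Z : A) (i : hom X Y) (p : hom Y Z) :
  mono i -> p ∘ i = 0 ->
  (forall (W : A) (w : hom W Y), proj W -> p ∘ w = 0 -> exists v, i ∘ v = w) ->
  (forall (W : A) (w : hom W Z), proj W -> exists v, p ∘ v = w) ->
  short_exact i p.
Proof.
move=> im pi0 ex ep; have ik : is_kernel p i.
  split=> // W w pw; have [|v vE] := proj_el_factor (f := w) im.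
    by move=> V t pV; apply: ex => //; rewrite compA pw comp0m.
  by exists v; split=> // v' v'E; apply: im; rewrite vE v'E.
by split=> //; apply: epi_cokernel ik; exact: proj_el_epi.
Qed.

(** The homology vanishes exactly when every element of the kernel comes from an
    element along [f]. *)
Lemma homology_zeroP (X Y Z : A) (f : hom X Y) (g : hom Y Z) (gf0 : g ∘ f = 0) :
  is_zero (homology gf0) <->
  forall (W : A) (w : hom W Y), proj W -> g ∘ w = 0 -> exists v, f ∘ v = w.
Proof.
set k := klift (comp_im0 gf0); have kE : ker g ∘ k = im f := kliftE (comp_im0 gf0).
split=> [[_ z] W w pW gw|ex].
  apply: proj_lift => //.
  have ke : epi k.
    apply: epi0 => V u uk; have [u' [<- _]] := (cokerP k).2 _ _ uk.
    by rewrite [u'](z _ u') comp0m.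
  suff ck : coker f ∘ ker g = 0 by rewrite -(kliftE gw) compA ck comp0m.
  by apply: (epi_eq0 ke); rewrite -compA kE (kerP (coker f)).1.
have ck : coker f ∘ ker g = 0.
  apply: proj_el_eq => W w pW; rewrite comp0m -compA.
  have [|v <-] := ex W (ker g ∘ w) pW; first by rewrite compA (kerP g).1 comp0m.
  by rewrite compA (cokerP f).1 comp0m.
have ku : k ∘ klift ck = idm _.
  by apply: (@ker_mono _ _ _ g); rewrite compA kE (kliftE ck) compm1.
apply: is_zero_id; apply: (cokernel_epi (cokerP k)).
by rewrite comp1m comp0m -[coker k]compm1 -ku compA (cokerP k).1 comp0m.
Qed.

End Frobenius.

(** * Choosing sections step by step *)

(** A value in degree 0 extends to a family over all integers whose consecutive
    members are related, if one can always move one step up and one step down. *)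
Lemma int_dep_choice (T : int -> Type) (R : forall n, T n -> T (n + 1) -> Prop)
    (t0 : T 0) :
  (forall n (x : T n), exists y, R n x y) ->
  (forall n (y : T (n + 1)), exists x, R n x y) ->
  exists t : forall n, T n, t 0 = t0 /\ forall n, R n (t n) (t (n + 1)).
Proof.
move=> up dn.
pose cast m n (e : m = n) (x : T m) : T n := ecast k (T k) e x.
have castK m n (e : m = n) (e' : n = m) x : cast _ _ e' (cast _ _ e x) = x.
  by case: _ / e e' => e'; rewrite (eq_irrelevance e' erefl).
have posS k : Posz k + 1 = Posz k.+1 by lia.
have neg0 : Negz 0 + 1 = 0 by [].
have negS k : Negz k.+1 + 1 = Negz k by lia.
pose u n x := sval (cid (up n x)).
have uP n x : R n x (u n x) := svalP (cid (up n x)).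
pose d n y := sval (cid (dn n y)).
have dP n y : R n (d n y) y := svalP (cid (dn n y)).
pose p := fix p k : T (Posz k) :=
  if k is k'.+1 then cast _ _ (posS k') (u _ (p k')) else t0.
pose q := fix q k : T (Negz k) :=
  if k is k'.+1 then d (Negz k'.+1) (cast _ _ (esym (negS k')) (q k'))
  else d (Negz 0) (cast _ _ (esym neg0) t0).
pose t n := match n with Posz k => p k | Negz k => q k end.
have tE m n (e : m = n) : t n = cast _ _ e (t m) by case: _ / e.
exists t; split=> // -[k|[|k]].
- by rewrite (tE _ _ (esym (posS k))) /= castK.
- by rewrite (tE _ _ (esym neg0)) /=.
- by rewrite (tE _ _ (esym (negS k))) /=.
Qed.

Section OrdChoice.
Variables (m : nat) (T : 'I_m.+1 -> Type).
Variable R : forall i : 'I_m, T (widen_ord (leqnSn m) i) -> T (lift ord0 i) -> Prop.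

Let cast j k (e : j = k) (x : T j) : T k := ecast l (T l) e x.

Let castK j k (e : j = k) (e' : k = j) x : cast e' (cast e x) = x.
Proof. by case: _ / e e' => e'; rewrite (eq_irrelevance e' erefl). Qed.

Lemma ord_dep_choice (t0 : T ord0) :
  (forall i (x : T (widen_ord (leqnSn m) i)), exists y, R x y) ->
  exists t : forall k, T k, t ord0 = t0 /\
    forall i, R (t (widen_ord (leqnSn m) i)) (t (lift ord0 i)).
Proof.
move=> up.
pose u i x := sval (cid (up i x)).
have uP i x : R x (u i x) := svalP (cid (up i x)).
have e0 (h : (0 < m.+1)%N) : ord0 = Ordinal h by exact: val_inj.
have eS k (h : (k.+1 < m.+1)%N) : lift ord0 (Ordinal (h : (k < m)%N)) = Ordinal h.
  exact: val_inj.
have eW k (h : (k.+1 < m.+1)%N) :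
    Ordinal (ltnW h) = widen_ord (leqnSn m) (Ordinal (h : (k < m)%N)).
  exact: val_inj.
pose p := fix p k : forall h : (k < m.+1)%N, T (Ordinal h) :=
  match k with
  | 0 => fun h => cast (e0 h) t0
  | k'.+1 => fun h => cast (eS k' h) (u _ (cast (eW k' h) (p k' (ltnW h))))
  end.
pose t k := cast (val_inj (erefl : val (Ordinal (ltn_ord k)) = val k)) (p k (ltn_ord k)).
have tE j k (e : j = k) : t k = cast e (t j) by case: _ / e.
have tp k (h : (k < m.+1)%N) : t (Ordinal h) = p k h.
  rewrite /t /=; move: (ltn_ord _) (val_inj _) => h' e'.
  by rewrite (bool_irrelevance h' h) in e' *; rewrite (eq_irrelevance e' erefl).
exists t; split.
  by rewrite (tE _ _ (esym (e0 (ltn0Sn m)))) tp /= castK.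
case=> k hk.
rewrite (tE _ _ (esym (eS k hk))) (tE _ _ (eW k hk)) !tp /= castK.
exact: uP.
Qed.

End OrdChoice.

Lemma ord_dep_choice_down m (T : 'I_m.+1 -> Type)
    (R : forall i : 'I_m, T (widen_ord (leqnSn m) i) -> T (lift ord0 i) -> Prop)
    (t0 : T ord_max) :
  (forall i (y : T (lift ord0 i)), exists x, R i x y) ->
  exists t : forall k, T k, t ord_max = t0 /\
    forall i, R i (t (widen_ord (leqnSn m) i)) (t (lift ord0 i)).
Proof.
move=> dn.
have e0 : rev_ord ord0 = ord_max :> 'I_m.+1 by apply: val_inj => /=; lia.
have eW (i : 'I_m) : rev_ord (widen_ord (leqnSn m) i) = lift ord0 (rev_ord i).
  by apply: val_inj => /=; rewrite /bump /=; have := ltn_ord i; lia.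
have eS (i : 'I_m) : rev_ord (lift ord0 i) = widen_ord (leqnSn m) (rev_ord i).
  by apply: val_inj => /=; rewrite /bump /=; have := ltn_ord i; lia.
pose cast j k (e : j = k) (x : T j) : T k := ecast l (T l) e x.
have castK j k (e : j = k) (e' : k = j) x : cast _ _ e' (cast _ _ e x) = x.
  by case: _ / e e' => e'; rewrite (eq_irrelevance e' erefl).
pose T' k := T (rev_ord k).
pose R' (i : 'I_m) (x : T' (widen_ord (leqnSn m) i)) (y : T' (lift ord0 i)) :=
  R (rev_ord i) (cast _ _ (eS i) y) (cast _ _ (eW i) x).
have [|t [tt0 tR]] := @ord_dep_choice m T' R' (cast _ _ (esym e0) t0).
  move=> i x; have [y yP] := dn _ (cast _ _ (eW i) x).
  by exists (cast _ _ (esym (eS i)) y); rewrite /R' castK.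
have tE j k (e : j = k) : t k = ecast l (T' l) e (t j) by case: _ / e.
pose s k := cast _ _ (rev_ordK k) (t (rev_ord k)).
have sE j (k : 'I_m.+1) (e : rev_ord j = k) : s k = cast _ _ e (t j).
  case: _ / e; rewrite /s (tE _ _ (esym (rev_ordK j))).
  move: (esym _) (rev_ordK (rev_ord j)); set l := rev_ord _.
  by move=> e; case: _ / e => e'; rewrite (eq_irrelevance e' erefl).
exists s; split=> [|i]; first by rewrite (sE _ _ e0) tt0 castK.
have := tR (rev_ord i); rewrite /R'.
move: (eS _) (eW _); rewrite rev_ordK => e1 e2.
by rewrite -sE -sE.
Qed.

Lemma ord_ind_down m (p : 'I_m.+1 -> Prop) : p ord_max ->
  (forall i : 'I_m, p (lift ord0 i) -> p (widen_ord (leqnSn m) i)) -> forall k, p k.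
Proof.
move=> pm pS; suff pn n (k : 'I_m.+1) : (k + n = m)%N -> p k.
  by move=> k; apply: (pn (m - k)%N); have := ltn_ord k; lia.
elim: n k => [|n IHn] k kn.
  by rewrite (_ : k = ord_max) //; apply: val_inj => /=; lia.
have km : (k < m)%N by lia.
rewrite (_ : k = widen_ord (leqnSn m) (Ordinal km)); last exact: val_inj.
by apply/pS/IHn; rewrite /= /bump /=; lia.
Qed.

Lemma sum_ord_last (V : zmodType) n (G : nat -> V) : (0 < n)%N ->
  \sum_(k < n) G k = \sum_(k < n.-1) G k + G n.-1.
Proof. by case: n => // n _; rewrite big_ord_recr. Qed.

Lemma sum_ord_first (V : zmodType) n (G : nat -> V) : (0 < n)%N ->
  \sum_(k < n) G k = G 0%N + \sum_(k < n.-1) G k.+1.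
Proof. by case: n => // n _; rewrite big_ord_recl. Qed.

(** * Powers of the differential *)

Section DD.
Variables (A : abcat) (N : nat).

(** The power of the differential from degree [m] to degree [n], taken to be
    zero when [n < m]. *)
Definition dd (X : ncomplex A N) (m n : int) : hom (X m) (X n) :=
  match shift m `|n - m|%N =P n with
  | ReflectT e => diter_to (cd X) e
  | ReflectF _ => 0
  end.

Lemma diter_toE (X : ncomplex A N) (m n : int) r (e : shift m r = n) :
  diter_to (cd X) e = dd X m n.
Proof.
have er : r = `|n - m|%N by move: e; rewrite shiftE; lia.
rewrite /dd; case: eqP => [e'|]; last by rewrite -er.
by case: _ / er e' => e'; rewrite (eq_irrelevance e e').
Qed.

Lemma diterE (X : ncomplex A N) (n : int) r :
  diter (cd X) n r = dd X n (shift n r).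
Proof. by rewrite -(diter_toE _ erefl). Qed.

Lemma ddnn (X : ncomplex A N) (n : int) : dd X n n = idm (X n).
Proof. by rewrite -(@diter_toE X n n 0 erefl). Qed.

Lemma cdE (X : ncomplex A N) (n : int) : cd X n = dd X n (n + 1).
Proof. by rewrite -(@diter_toE X n (n + 1) 1 erefl) /diter_to /= compm1. Qed.

Lemma dd_comp (X : ncomplex A N) (m n p : int) : m <= n <= p ->
  dd X n p ∘ dd X m n = dd X m p.
Proof.
move=> mnp.
have e1 : shift m `|n - m|%N = n by rewrite shiftE; lia.
have e2 : shift n `|p - n|%N = p by rewrite shiftE; lia.
have e3 : shift m (`|p - n| + `|n - m|)%N = p by rewrite shiftE; lia.
by rewrite -(diter_toE X e1) -(diter_toE X e2) (diter_to_comp _ _ _ e3) diter_toE.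
Qed.

Lemma dd_ge0 (X : ncomplex A N) (m n : int) : m + N%:Z <= n -> dd X m n = 0.
Proof.
move=> mn; rewrite -(@dd_comp X m (shift m N) n) ?shiftE -?shiftE; last first.
  by rewrite shiftE; lia.
by rewrite -diterE cdN compm0.
Qed.

Lemma dd_lt0 (X : ncomplex A N) (m n : int) : n < m -> dd X m n = 0.
Proof. by rewrite /dd => nm; case: eqP => // e; have := e; rewrite shiftE; lia. Qed.

Lemma dd_cmap (X Y : ncomplex A N) (f : cmor X Y) (m n : int) :
  dd Y m n ∘ f m = f n ∘ dd X m n.
Proof.
case: (leP m n) => [mn|nm]; last by rewrite !dd_lt0 // comp0m compm0.
have e : shift m `|n - m|%N = n by rewrite shiftE; lia.
by rewrite -!(diter_toE _ e) cmap_diter_to.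
Qed.

End DD.

(** * Generalities on exact categories and functors *)

Lemma projinj_retract (E : excat) (P Q : E) (s : hom P Q) (r : hom Q P) :
  r ∘ s = idm P -> projinj Q -> projinj P.
Proof.
move=> rs [pQ iQ]; split=> X Y Z i p ip f.
- have [g gE] := pQ _ _ _ _ _ ip (f ∘ r).
  by exists (g ∘ s); rewrite compA gE -compA rs compm1.
- have [g gE] := iQ _ _ _ _ _ ip (s ∘ f).
  by exists (r ∘ g); rewrite -compA gE compA rs comp1m.
Qed.

Lemma additive_functorB (C D : preadd) (G : functor C D) :
  additive_functor G -> forall (X Y : C) (f g : hom X Y),
  fmap G (f - g) = fmap G f - fmap G g.
Proof. by move=> Ga X Y f g; apply: (addIr (fmap G g)); rewrite -Ga !subrK. Qed.

(** * Exactness in terms of elements *)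

Section AcyclicComplexes.
Variables (A : abcat) (N : nat).
Hypotheses (hA : frobenius (ab_excat A)) (hN : (2 <= N)%N).

Local Notation proj P := (@projective (ab_excat A) P).
Local Notation inj I := (@injective (ab_excat A) I).

(** Acyclicity, for elements and including the trivial cases [r = 0] and
    [r = N], where [r = p - n]. *)
Lemma acyclicP (X : ncomplex A N) : acyclic X <->
  forall m n p : int, m <= n <= p -> p = m + N%:Z ->
  forall (W : A) (w : hom W (X n)), proj W -> dd X n p ∘ w = 0 ->
  exists v, dd X m n ∘ v = w.
Proof.
split=> [ac m n p mnp pE W w pW|ex n r hr]; last first.
  apply/(homology_zeroP hA) => W w pW; rewrite /bnd diter_toE diterE => dw.
  by apply: ex dw; rewrite // shiftE; lia.
have [-> dw|mn] := eqVneq m n; first by exists w; rewrite ddnn comp1m.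
have [<-|np] := eqVneq n p.
  by rewrite ddnn comp1m => ->; exists 0; rewrite compm0.
have hr : (0 < `|p - n| < N)%N by lia.
have pS : p = shift n `|p - n| by rewrite shiftE; lia.
have mS : m = n - N%:Z + `|p - n|%N%:Z by lia.
move: hr pS mS; move: `|p - n|%N => r hr -> ->; rewrite -diterE => dw.
have [v vE] := (homology_zeroP hA _).1 (ac n r hr) W w pW dw.
by exists v; rewrite -vE /bnd diter_toE.
Qed.

Lemma dd_exact (X : ncomplex A N) (m n p : int) (W : A) (w : hom W (X n)) :
  acyclic X -> proj W -> m <= n <= p -> p = m + N%:Z -> dd X n p ∘ w = 0 ->
  exists v, dd X m n ∘ v = w.
Proof. by move=> /acyclicP ac pW mnp pE; apply: (ac m n p). Qed.

Lemma dd_Zin (X : ncomplex A N) (r : nat) : dd X 0 r%:Z ∘ Zin X 0 r = 0.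
Proof.
have : diter (cd X) 0 r ∘ Zin X 0 r = 0 := (kerP (diter (cd X) 0 r)).1.
by move: (Zin X 0 r) => z; rewrite diterE shiftE add0r.
Qed.

Lemma Zin_factor (X : ncomplex A N) (r : nat) (W : A) (w : hom W (X 0)) :
  dd X 0 r%:Z ∘ w = 0 -> exists v, Zin X 0 r ∘ v = w.
Proof.
move=> dw; have dw' : diter (cd X) 0 r ∘ w = 0.
  by rewrite diterE shiftE add0r.
by exists (klift dw'); exact: kliftE.
Qed.

(** * Extending morphisms of cycles to morphisms of complexes *)

Section Fullness.
Variables P Q : CNacP A N.
Let X : ncomplex A N := sval P.
Let Y : ncomplex A N := sval Q.

Let acX : acyclic X. Proof. exact: (svalP P).1. Qed.
Let acY : acyclic Y. Proof. exact: (svalP Q).1. Qed.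
Let pX n : proj (X n). Proof. exact: (svalP P).2. Qed.
Let pY n : proj (Y n). Proof. exact: (svalP Q).2. Qed.

(** A map in a single degree that sends [Z_r] to [Z_r] for every [r]. *)
Definition preserves_cycles (n : int) (g : hom (X n) (Y n)) :=
  forall (p : int) (W : A) (w : hom W (X n)), proj W -> n <= p ->
  dd X n p ∘ w = 0 -> dd Y n p ∘ (g ∘ w) = 0.

Lemma preserves_cycles_up n (g : hom (X n) (Y n)) : preserves_cycles g ->
  exists g' : hom (X (n + 1)) (Y (n + 1)),
    preserves_cycles g' /\ cd Y n ∘ g = g' ∘ cd X n.
Proof.
move=> gZ.
have [||g' g'E] := @inj_el_ext A hA _ _ _ (cd X n) (cd Y n ∘ g).
- exact: proj_inj.
- by move=> W w pW; rewrite -compA !cdE => /gZ -> //; lia.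
exists g'; split=> // p W w pW np dw.
have [|dv] := leP (n + 1 + N%:Z) p; first by move=> ?; rewrite dd_ge0 // comp0m.
have [v vE] : exists v, dd X n (n + 1) ∘ v = w.
  apply: (dd_exact (p := n + N%:Z)) => //; first by lia.
  by rewrite -(@dd_comp _ _ _ _ p) -?compA ?dw ?compm0 //; lia.
rewrite -vE -cdE (compA g') g'E cdE !compA dd_comp; last by lia.
rewrite -compA gZ //; first by lia.
by rewrite -(@dd_comp _ _ _ _ (n + 1)) -?compA ?vE //; lia.
Qed.

Lemma preserves_cycles_down n (g : hom (X (n + 1)) (Y (n + 1))) :
  preserves_cycles g ->
  exists g' : hom (X n) (Y n), preserves_cycles g' /\ cd Y n ∘ g' = g ∘ cd X n.
Proof.
move=> gZ.
have [g' g'E] : exists g', dd Y n (n + 1) ∘ g' = g ∘ cd X n.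
  apply: (dd_exact (p := n + N%:Z)) => //; first by lia.
  by apply: gZ => //; [lia | rewrite cdE dd_comp ?dd_ge0 //; lia].
exists g'; rewrite cdE g'E; split=> // p W w pW np dw.
have [np1|pn1] := leP (n + 1) p.
  rewrite -(@dd_comp _ _ _ _ (n + 1)); last by lia.
  rewrite compA -(compA (dd Y (n + 1) p)) g'E -!compA; apply: gZ => //.
  by rewrite compA cdE dd_comp //; lia.
have pn : p = n by lia.
by move: dw; rewrite pn ddnn comp1m => ->; rewrite !compm0.
Qed.

Lemma preserves_cycles_cmor (g : hom (X 0) (Y 0)) : preserves_cycles g ->
  exists f : cmor X Y, f 0 = g.
Proof.
move=> gZ.
pose T n := {g : hom (X n) (Y n) | preserves_cycles g}.
pose R n (g : T n) (g' : T (n + 1)) := cd Y n ∘ sval g = sval g' ∘ cd X n.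
have [||t [t0 tR]] := @int_dep_choice T R (exist _ g gZ).
- move=> n [f fZ]; have [f' [f'Z f'E]] := preserves_cycles_up fZ.
  by exists (exist _ f' f'Z).
- move=> n [f fZ]; have [f' [f'Z f'E]] := preserves_cycles_down fZ.
  by exists (exist _ f' f'Z).
by exists (@Cmor _ _ X Y (fun n => sval (t n)) tR) => /=; rewrite t0.
Qed.

End Fullness.

(** For the underlying complexes [X] and [Y], the component of [phi] on [Z_(N-1)]
    extends to a map [X^0 -> Y^0], since [Y^0] is injective; the other components
    are its restrictions. *)
Lemma F_full (P Q : CNacP A N) (phi : hom (F A N P) (F A N Q)) :
  exists f : hom P Q, fmap (F A N) f = phi.
Proof.
pose X : ncomplex A N := sval P; pose Y : ncomplex A N := sval Q.
have [g gE] := inj_mono_ext (Zin Y 0 N.-2.+1 ∘ mmap phi ord_max)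
  (proj_inj hA ((svalP Q).2 0)) (@Zin_mono _ _ X 0 N.-2.+1).
have gZ k : g ∘ Zin X 0 (val k).+1 = Zin Y 0 (val k).+1 ∘ mmap phi k.
  elim/ord_ind_down: k => // i IHi.
  have e : val (lift ord0 i) = i.+1 by [].
  have := congr1 (fun u => u ∘ Zincl X 0 i.+1) IHi.
  rewrite -compA [X in _ ∘ X = _ -> _]ZinclE -compA => ->.
  have := mmapP phi i => /= ->.
  by rewrite compA [X in X ∘ _]ZinclE.
have [|f f0] := @preserves_cycles_cmor P Q g.
  move=> p W w pW p0 dw.
  have [np|pn] := leP (0 + N%:Z) p; first by rewrite dd_ge0 // comp0m.
  have [p00|p_gt0] := eqVneq p 0.
    by move: dw; rewrite p00 ddnn comp1m => ->; rewrite !compm0.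
  have kN : (`|p|.-1 < N.-2.+1)%N by lia.
  have pE : p = (Ordinal kN).+1%:Z by rewrite /=; lia.
  move: dw; rewrite pE => /Zin_factor [v <-].
  by rewrite (compA g) gZ -compA (compA (dd _ _ _)) dd_Zin comp0m.
exists f; apply: mmor_eq => k; apply: Zin_mono.
by rewrite [LHS]ZmapE f0 gZ.
Qed.

(** * Null-homotopies *)

Section Homotopy.
Variables X Y : ncomplex A N.
Implicit Type h : forall j, hom (X j) (Y (j - N%:Z + 1)).

(** The contribution of [h j] to the homotopy formula in degree [i]. *)
Definition hterm h (i j : int) : hom (X i) (Y i) :=
  dd Y (j - N%:Z + 1) i ∘ h j ∘ dd X i j.

Lemma null_homotopicP (f : cmor X Y) : null_homotopic f <->
  exists h, forall i, f i = \sum_(k < N) hterm h i (i + k%:Z).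
Proof.
suff hE h i : \sum_(k < N) diter_to (cd Y) (htp_index i (ltn_ord k))
                   ∘ h (shift i k) ∘ diter (cd X) i k =
              \sum_(k < N) hterm h i (i + k%:Z).
  by split=> -[h hP]; exists h => i; rewrite hP hE.
by apply: eq_bigr => k _; rewrite diter_toE diterE -/(hterm h i _) shiftE.
Qed.

Lemma eq_hterm h h' i j : h j = h' j -> hterm h i j = hterm h' i j.
Proof. by rewrite /hterm => ->. Qed.

Lemma cd_hterm h (n j : int) : n < j < n + N%:Z ->
  cd Y n ∘ hterm h n j = hterm h (n + 1) j ∘ cd X n.
Proof.
move=> nj; rewrite /hterm !cdE !compA dd_comp; last by lia.
by rewrite -!compA dd_comp //; lia.
Qed.

(** The terms of the homotopy formula that degrees [n] and [n + 1] share. *)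
Let common h (i n : int) := \sum_(k < N.-1) hterm h i (n + k.+1%:Z).

Let eq_common h h' i n : (forall j, n < j < n + N%:Z -> h j = h' j) ->
  common h i n = common h' i n.
Proof.
by move=> hh'; apply: eq_bigr => k _; apply/eq_hterm/hh'; have := ltn_ord k; lia.
Qed.

Let cd_common h n : cd Y n ∘ common h n n = common h (n + 1) n ∘ cd X n.
Proof.
rewrite comp_sumr comp_suml; apply: eq_bigr => k _.
by apply: cd_hterm; have := ltn_ord k; lia.
Qed.

Let sum_first h n :
  \sum_(k < N) hterm h n (n + k%:Z) = hterm h n n + common h n n.
Proof.
by rewrite (sum_ord_first (fun k => hterm h n (n + k%:Z))) ?addr0 //; lia.
Qed.

Let sum_last h n : \sum_(k < N) hterm h (n + 1) (n + 1 + k%:Z) =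
  common h (n + 1) n + hterm h (n + 1) (n + N%:Z).
Proof.
rewrite (sum_ord_last (fun k => hterm h (n + 1) (n + 1 + k%:Z))); last by lia.
congr (_ + _); last by congr hterm; lia.
by apply: eq_bigr => k _; congr hterm; lia.
Qed.

Hypotheses (acX : acyclic X) (acY : acyclic Y).
Hypotheses (pX : forall n, proj (X n)) (pY : forall n, proj (Y n)).

(** A homotopy formula in degree 0 propagates to all degrees: upwards because
    the entries of [Y] are injective, downwards because those of [X] are
    projective. *)
Lemma null_homotopic_from0 (f : cmor X Y) h :
  f 0 = \sum_(k < N) hterm h 0 (0 + k%:Z) -> null_homotopic f.
Proof.
move=> f0; pose T n := {h | f n = \sum_(k < N) hterm h n (n + k%:Z)}.
pose R n (x : T n) (y : T (n + 1)) :=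
  forall j, n < j < n + N%:Z -> sval x j = sval y j.
have [||t [_ tR]] := @int_dep_choice T R (exist _ h f0).
- move=> n [g gE].
  have [||x xE] := @inj_el_ext A hA _ _ _ (dd X (n + 1) (n + N%:Z))
    (f (n + 1) - common g (n + 1) n).
  + exact: proj_inj.
  + move=> W w pW dw; have [v <-] : exists v, dd X n (n + 1) ∘ v = w.
      by apply: (dd_exact (p := n + N%:Z)) => //; lia.
    rewrite compA compBl -cdE -cmapP -cd_common -compBr gE sum_first addrK.
    rewrite /hterm cdE !compA dd_comp; last by lia.
    by rewrite dd_ge0 ?comp0m //; lia.
  (* this power of d is the identity, between provably equal degrees *)
  pose y := dd Y (n + 1) (n + N%:Z - N%:Z + 1) ∘ x.
  have gE' j : n < j < n + N%:Z -> g j = dfwith g y j.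
    by move=> nj; rewrite dfwith_out //; lia.
  suff g'E : f (n + 1) = \sum_(k < N) hterm (dfwith g y) (n + 1) (n + 1 + k%:Z).
    by exists (exist _ (dfwith g y) g'E) => j nj /=; exact: gE'.
  rewrite sum_last -(eq_common _ gE') /hterm dfwith_in /y compA dd_comp; last by lia.
  by rewrite ddnn comp1m xE [RHS]addrC subrK.
- move=> n [g gE].
  have [v vE] : exists v, dd Y (n - N%:Z + 1) n ∘ v = f n - common g n n.
    apply: (dd_exact (p := n + 1)) => //; first by lia.
      by lia.
    rewrite compBr -cdE cmapP cd_common -compBl gE sum_last [X in X - _]addrC addrK.
    by rewrite /hterm cdE -!compA dd_comp ?(@dd_ge0 _ _ X) ?compm0 ?compm0 //; lia.
  have gE' j : n < j < n + N%:Z -> dfwith g v j = g j.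
    by move=> nj; rewrite dfwith_out //; lia.
  suff g'E : f n = \sum_(k < N) hterm (dfwith g v) n (n + k%:Z).
    by exists (exist _ (dfwith g v) g'E) => j nj /=; exact: gE'.
  by rewrite sum_first (eq_common _ gE') /hterm dfwith_in ddnn compm1 vE subrK.
apply/null_homotopicP; exists (fun j => sval (t j) j) => n.
have tE (k : nat) m j : (k < N)%N -> j = m + k%:Z -> sval (t m) j = sval (t j) j.
  elim: k m => [|k IHk] m kN jE; first by rewrite jE addr0.
  by rewrite tR ?(IHk (m + 1)) //; lia.
rewrite {1}(svalP (t n)); apply: eq_bigr => k _; apply: eq_hterm.
exact: (tE k).
Qed.

End Homotopy.

(** If [F f = 0] then [f 0] kills [Z_(N-1)], so it factors through [d^(N-1)]. *)
Lemma F_map0_null_homotopic (P Q : CNacP A N) (f : hom P Q) :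
  fmap (F A N) f = 0 -> null_homotopic f.
Proof.
move=> Ff0; pose X : ncomplex A N := sval P; pose Y : ncomplex A N := sval Q.
have [acX pX] := svalP P; have [acY pY] := svalP Q.
have [||x xE] := @inj_el_ext A hA _ _ _ (dd X 0 N.-1%:Z) (f 0).
- exact/proj_inj/pY.
- move=> W w pW; have -> : N.-1%:Z = N.-2.+1%:Z by lia.
  move=> /Zin_factor [v <-].
  have := congr1 (fun u => mmap u ord_max) Ff0.
  move=> /(congr1 (comp (Zin Y 0 N.-2.+1))); rewrite [LHS]ZmapE [RHS]compm0.
  by rewrite compA => ->; rewrite comp0m.
(* [N - 1 - N + 1 = 0]: this power of d is the identity *)
pose y := dd Y 0 (N.-1%:Z - N%:Z + 1) ∘ x.
pose h := @dfwith _ (fun j => hom (X j) (Y (j - N%:Z + 1))) (fun=> 0) _ y.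
apply: (@null_homotopic_from0 X Y acX acY pX pY f h).
rewrite (sum_ord_last (fun k => hterm _ 0 (0 + k%:Z))); last by lia.
rewrite big1 ?add0r => [|k _].
  by rewrite /hterm /h dfwith_in /y compA dd_comp ?ddnn ?comp1m ?xE //; lia.
rewrite /hterm /h dfwith_out; last by have := ltn_ord k; lia.
by rewrite compm0 comp0m.
Qed.

(** * Short exact sequences of acyclic complexes *)

(** A cycle of the quotient lifts to a cycle of the middle term: any lift can be
    corrected by an element of the acyclic subcomplex. *)
Lemma acyclic_quotient (X Y Z : ncomplex A N) (i : cmor X Y) (p : cmor Y Z) :
  (forall n, short_exact (i n) (p n)) -> acyclic X -> acyclic Y -> acyclic Z.
Proof.
move=> ip acX acY; apply/acyclicP => m n q mnq qE W w pW dw.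
have [y yE] := short_exact_lift w (ip n) pW.
have [|x xE] := short_exact_factor (w := dd Y n q ∘ y) (ip q).
  by rewrite compA -dd_cmap -compA yE.
have [z zE] : exists z, dd X n q ∘ z = x.
  apply: (dd_exact (p := n + N%:Z)) => //; first by lia.
  apply: (mono_eq0 (kernel_mono (ip _).1)).
  by rewrite compA -dd_cmap -compA xE compA dd_comp ?dd_ge0 ?comp0m //; lia.
have [t tE] : exists t, dd Y m n ∘ t = y - i n ∘ z.
  apply: (dd_exact (p := q)) => //.
  by rewrite compBr -xE -zE !compA dd_cmap subrr.
exists (p m ∘ t); rewrite compA dd_cmap -compA tE compBr yE compA.
by rewrite (ip n).1.1 comp0m subr0.
Qed.

Lemma F_exact (P Q R : CNacP A N) (i : hom P Q) (p : hom Q R) :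
  conf i p -> conf (fmap (F A N) i) (fmap (F A N) p).
Proof.
move=> ip k; have {}ip n : short_exact (cmap i n) (cmap p n) := (ip n).1.
pose X : ncomplex A N := sval P; pose Y : ncomplex A N := sval Q.
pose Z : ncomplex A N := sval R; set r := k.+1.
rewrite /= -/r; have rN : (r < N)%N by rewrite /r; have := ltn_ord k; lia.
have im n : mono (cmap i n) by exact: kernel_mono (ip n).1.
have liftX (W : A) (w : hom W (X 0)) :
    dd Y 0 r%:Z ∘ (i 0 ∘ w) = 0 -> exists v, Zin X 0 r ∘ v = w.
  rewrite compA dd_cmap -compA => /(mono_eq0 (im _)) dw.
  exact: Zin_factor dw.
apply: (short_exact_el hA).
- move=> W u v /(congr1 (comp (Zin Y 0 r))); rewrite !compA !ZmapE -!compA.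
  by move=> /im /Zin_mono.
- apply: Zin_mono; rewrite compm0 compA ZmapE -compA ZmapE compA.
  by rewrite (ip 0).1.1 comp0m.
- move=> W w pW /(congr1 (comp (Zin Z 0 r))); rewrite compm0 compA ZmapE -compA.
  move=> /(short_exact_factor (ip 0)) [x xE].
  have [|v vE] := liftX _ x; first by rewrite xE compA dd_Zin comp0m.
  by exists v; apply: Zin_mono; rewrite compA ZmapE -compA vE xE.
- move=> W w pW.
  have [y yE] := short_exact_lift (Zin Z 0 r ∘ w) (ip 0) pW.
  have [|x xE] := short_exact_factor (w := dd Y 0 r%:Z ∘ y) (ip r%:Z).
    by rewrite compA -dd_cmap -compA yE compA dd_Zin comp0m.
  have [z zE] : exists z, dd X 0 r%:Z ∘ z = x.
    apply: (dd_exact (p := N%:Z) (svalP P).1) => //; first by lia.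
    apply: (mono_eq0 (im _)); rewrite compA -dd_cmap -compA xE.
    by rewrite compA dd_comp ?dd_ge0 ?comp0m //; lia.
  have [|v vE] := @Zin_factor Y r _ (y - i 0 ∘ z).
    by rewrite compBr -xE -zE !compA dd_cmap subrr.
  exists v; apply: Zin_mono; rewrite compA ZmapE -compA vE compBr yE compA.
  by rewrite (ip 0).1.1 comp0m subr0.
Qed.

(** * Chains of projectives are projective and injective *)

Lemma MMor_projinj m (M : MMor A m) : (forall k, proj (mob M k)) -> projinj M.
Proof.
move=> pM; have iM k : inj (mob M k) by exact: proj_inj.
split=> X Y Z i p ip f.
- have lift k : exists g, mmap p k ∘ g = mmap f k.
    exact: short_exact_lift (ip k) (pM k).
  pose T k := {g : hom (mob M k) (mob Y k) | mmap p k ∘ g = mmap f k}.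
  pose R (j : 'I_m) (g : T (widen_ord (leqnSn m) j)) (g' : T (fintype.lift ord0 j)) :=
    sval g' ∘ marr M j = marr Y j ∘ sval g.
  have [g0 g0E] := lift ord0.
  have [|t [_ tR]] := @ord_dep_choice m T R (exist _ g0 g0E); last first.
    exists (@Mmor A m M Y (fun k => sval (t k)) tR).
    by apply: mmor_eq => k; exact: (svalP (t k)).
  move=> j [g gE]; have [l lE] := lift (fintype.lift ord0 j).
  (* split the mono marr M j, whose source is injective *)
  have [q qE] := inj_mono_ext (idm _) (iM _) (@marr_mono _ _ M j).
  set g' := marr Y j ∘ g ∘ q + l ∘ (idm _ - marr M j ∘ q).
  have g'E : mmap p (fintype.lift ord0 j) ∘ g' = mmap f (fintype.lift ord0 j).
    rewrite compDr !compA mmapP -(compA (marr Z j)) gE lE -mmapP -!compA.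
    by rewrite -compDr addrC subrK compm1.
  exists (exist _ g' g'E); rewrite /R /= compDl -!compA qE compm1.
  by rewrite compBl comp1m -compA qE compm1 subrr compm0 addr0.
- pose T k := {g : hom (mob Y k) (mob M k) | g ∘ mmap i k = mmap f k}.
  pose R (j : 'I_m) (g : T (widen_ord (leqnSn m) j)) (g' : T (fintype.lift ord0 j)) :=
    sval g' ∘ marr Y j = marr M j ∘ sval g.
  have im k : mono (mmap i k) by exact: kernel_mono (ip k).1.
  have [g0 g0E] := inj_mono_ext (mmap f ord0) (iM _) (im ord0).
  have [|t [_ tR]] := @ord_dep_choice m T R (exist _ g0 g0E); last first.
    exists (@Mmor A m Y M (fun k => sval (t k)) tR).
    by apply: mmor_eq => k; exact: (svalP (t k)).
  move=> j [g gE].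
  have [[_ bip] _ _ _ _] := abcatP A.
  have [S [i1 [i2 [p1 [p2 [e11 e22 e12 e21 e]]]]]] := bip
    (mob X (fintype.lift ord0 j)) (mob Y (widen_ord (leqnSn m) j)).
  (* the new entry is prescribed on the image of X and on the previous entry
     of Y, which meet in the previous entry of X because Z is a chain of monos *)
  have [||g' g'E] := @inj_el_ext A hA _ _ _
      (mmap i (fintype.lift ord0 j) ∘ p1 + marr Y j ∘ p2)
      (mmap f (fintype.lift ord0 j) ∘ p1 + marr M j ∘ g ∘ p2).
  + exact: iM.
  + move=> W w pW; rewrite !compDl -!compA => w0.
    have [|x xE] := short_exact_factor (w := p2 ∘ w) (ip (widen_ord (leqnSn m) j)).
      apply: (@marr_mono _ _ Z j); rewrite compm0 compA -mmapP -compA.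
      have := congr1 (comp (mmap p (fintype.lift ord0 j))) w0.
      by rewrite compDr compA (ip _).1.1 comp0m add0r compm0.
    have x1 : p1 ∘ w = - (marr X j ∘ x).
      apply: (im (fintype.lift ord0 j)); apply/eqP; rewrite -subr_eq0 compNr opprK.
      by rewrite (compA _ (marr X j)) mmapP -compA xE w0.
    by rewrite x1 -xE compNr !compA mmapP -(compA (marr M j) g) gE addNr.
  have g'1 : g' ∘ mmap i (fintype.lift ord0 j) = mmap f (fintype.lift ord0 j).
    have := congr1 (fun u => u ∘ i1) g'E.
    by rewrite -compA !compDl -!compA e11 e21 !compm0 !addr0 !compm1.
  exists (exist _ g' g'1); rewrite /R /=.
  have := congr1 (fun u => u ∘ i2) g'E.
  by rewrite -compA !compDl -!compA e22 e12 !compm0 !add0r !compm1.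
Qed.

(** * The contractible complex attached to a complex *)

Section Contractible.
Variable X : ncomplex A N.

Let window (i : int) : seq int := [seq i + k%:Z | k <- iota 0 N].

Let mem_window i m : (m \in window i) = (i <= m < i + N%:Z).
Proof.
apply/mapP/idP => [[k]|im]; first by rewrite mem_iota => ? ->; lia.
by exists `|m - i|%N; rewrite ?mem_iota; lia.
Qed.

Let window_uniq i : uniq (window i).
Proof. by rewrite map_inj_uniq ?iota_uniq // => a b; lia. Qed.

(** The direct sum of [X m] over [i <= m < i + N], with projections to all [X m]
    that are zero outside this range. *)
Record window_sum (i : int) := WindowSum {
  wob : A;
  winj : forall m, hom (X m) wob;
  wprj : forall m, hom wob (X m);
  winjK : forall m, i <= m < i + N%:Z -> wprj m ∘ winj m = idm (X m);
  winj_neq : forall m n, m != n -> wprj m ∘ winj n = 0;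
  wprj0 : forall m, ~~ (i <= m < i + N%:Z) -> wprj m = 0;
  wsum : \sum_(m <- window i) winj m ∘ wprj m = idm wob }.

Fact window_sum_exists i : exists _ : window_sum i, True.
Proof.
have [S [j [p [ii ij p0 jp]]]] := finite_biproduct (fun m => X m) (window_uniq i).
suff W : window_sum i by exists W.
by exists S j p => // m; rewrite -mem_window; [exact: ii | exact: p0].
Qed.

Let W i : window_sum i := sval (cid (window_sum_exists i)).
Let I i : A := wob (W i).
Let pr i m : hom (I i) (X m) := wprj (W i) m.

Let pr_ext i (V : A) (u v : hom V (I i)) :
  (forall m, pr i m ∘ u = pr i m ∘ v) -> u = v.
Proof.
move=> uv; rewrite -(comp1m u) -(comp1m v) -(wsum (W i)) !comp_suml.
by apply: eq_bigr => m _; rewrite -!compA -/(pr i m) uv.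
Qed.

(** The map to the direct sum with components [g m] for [i <= m < i + N]. *)
Let tuple_map i (V : A) (g : forall m, hom V (X m)) : hom V (I i) :=
  \sum_(m <- window i) winj (W i) m ∘ g m.

Let pr_tuple_map i (V : A) (g : forall m, hom V (X m)) m :
  pr i m ∘ tuple_map i g = if i <= m < i + N%:Z then g m else 0.
Proof.
case: ifPn => [im|/wprj0 pr0]; last by rewrite /pr pr0 comp0m.
rewrite comp_sumr (bigD1_seq m) ?mem_window //= compA winjK // comp1m.
by rewrite big1 ?addr0 // => n nm; rewrite compA winj_neq 1?eq_sym // comp0m.
Qed.

Let dI i : hom (I i) (I (i + 1)) := tuple_map (i + 1) (pr i).

Let pr_dI i m : pr (i + 1) m ∘ dI i = if m < i + 1 then 0 else pr i m.
Proof.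
rewrite pr_tuple_map; case: ifPn => [im|im]; first by case: ifP => //; lia.
by case: ifPn => // im'; rewrite /pr wprj0 //; lia.
Qed.

Let pr_diter i r m :
  pr (shift i r) m ∘ diter dI i r = if m < shift i r then 0 else pr i m.
Proof.
elim: r => [|r IHr] /=.
  by rewrite compm1; case: ifPn => // mi; rewrite /pr wprj0 //; lia.
rewrite compA pr_dI; case: ifPn => [|mr]; first by rewrite comp0m.
by rewrite IHr; case: ifPn => //; move: mr; rewrite /=; lia.
Qed.

Fact contractible_dN n : diter dI n N = 0.
Proof.
apply: pr_ext => m; rewrite pr_diter compm0; case: ifPn => // mn.
by rewrite /pr wprj0 //; move: mn; rewrite shiftE; lia.
Qed.

(** In degree [i] it is the direct sum of the [X m] with [i <= m < i + N], and
    its differential forgets the summand [X i]. *)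
Definition contractible : ncomplex A N := NComplex contractible_dN.

Let pr_dd i n m : i <= n ->
  pr n m ∘ dd contractible i n = if m < n then 0 else pr i m.
Proof.
move=> iN; have e : n = shift i `|n - i|%N by rewrite shiftE; lia.
by rewrite e -diterE; exact: pr_diter.
Qed.

Lemma contractible_acyclic : acyclic contractible.
Proof.
apply/acyclicP => m n p mnp pE V w pV dw.
have w0 q : p <= q -> pr n q ∘ w = 0.
  move=> pq; have := congr1 (comp (pr p q)) dw.
  by rewrite compA pr_dd ?compm0; [case: ifPn => //|]; lia.
exists (tuple_map m (fun q => pr n q ∘ w)); apply: pr_ext => q.
rewrite compA pr_dd; last by lia.
case: ifPn => qn; first by rewrite comp0m /pr wprj0 ?comp0m //; lia.
rewrite pr_tuple_map; case: ifPn => // qm.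
by rewrite w0 //; lia.
Qed.

Lemma contractible_proj : (forall n, proj (X n)) -> forall n, proj (contractible n).
Proof. by move=> pX n; exact: (biproduct_proj (wsum (W n)) pX). Qed.

Lemma contractible_Zproj r : (forall n, proj (X n)) -> proj (Zob contractible 0 r).
Proof.
move=> pX; pose e := tuple_map 0 (fun m => if m < r%:Z then pr 0 m else 0).
have [|q qE] := @Zin_factor contractible r _ e.
  apply: pr_ext => m; rewrite compm0 compA pr_dd //.
  case: ifPn => mr; first by rewrite comp0m.
  by rewrite pr_tuple_map (negPf mr); case: ifP.
apply: (proj_retract (s := Zin contractible 0 r) (r := q)); last first.
  exact: contractible_proj.
apply: Zin_mono; rewrite compm1 compA qE; apply: pr_ext => m.
rewrite compA pr_tuple_map; have [mr|rm] := ltP m r%:Z.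
  by case: ifPn => // m0; rewrite /pr wprj0 // comp0m.
have -> : pr 0 m ∘ Zin contractible 0 r = 0.
  have := congr1 (comp (pr r%:Z m)) (dd_Zin contractible r).
  by rewrite compA pr_dd // compm0 ltNge rm.
by case: ifP; rewrite comp0m.
Qed.

(** The identity on the summands [X j] is a contracting homotopy: in degree [i]
    the term of index [j] of the homotopy formula is the projection to [X j]. *)
Lemma contractible_null_homotopic : null_homotopic (cmor1 contractible).
Proof.
pose h j : hom (contractible j) (contractible (j - N%:Z + 1)) :=
  winj (W (j - N%:Z + 1)) j ∘ pr j j.
apply/null_homotopicP; exists h => i.
apply: pr_ext => m; rewrite compm1 comp_sumr.
have hE (k : 'I_N) : pr i m ∘ hterm h i (i + k%:Z) =
    if m == i + k%:Z then pr i m else 0.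
  have kN := ltn_ord k.
  rewrite /hterm /h !compA pr_dd; last by lia.
  have [mi|mi] := ltP m i.
    rewrite !comp0m; case: eqP => // me; move: mi; rewrite me; lia.
  have [->|mk] := eqVneq m (i + k%:Z).
    rewrite {1}/pr winjK; last by lia.
    by rewrite comp1m pr_dd ?ltxx //; lia.
  by rewrite {1}/pr winj_neq // !comp0m.
rewrite (eq_bigr _ (fun k _ => hE k)) -big_mkcond /=.
have [im|im] := boolP (i <= m < i + N%:Z); last first.
  by rewrite /pr wprj0 // big1.
have kN : (`|m - i| < N)%N by lia.
rewrite (big_pred1 (Ordinal kN)) // => k /=.
by rewrite -val_eqE /=; lia.
Qed.

Fact contractible_in_proof n :
  dI n ∘ tuple_map n (dd X n) = tuple_map (n + 1) (dd X (n + 1)) ∘ cd X n.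
Proof.
apply: pr_ext => m; rewrite !compA pr_dI [in RHS]pr_tuple_map.
case: ifPn => mn; first by case: ifPn; rewrite ?comp0m //; lia.
rewrite pr_tuple_map; case: ifPn => nm; case: ifPn => nm'; rewrite ?comp0m //.
- by rewrite cdE dd_comp //; lia.
- by lia.
- by rewrite cdE dd_comp ?dd_ge0 //; lia.
Qed.

(** The canonical embedding of [X], whose components are the powers of [d]. *)
Definition contractible_in : cmor X contractible :=
  @Cmor _ _ X contractible (fun n => tuple_map n (dd X n)) contractible_in_proof.

Lemma contractible_in_split n :
  exists r : hom (contractible n) (X n), r ∘ contractible_in n = idm (X n).
Proof.
by exists (pr n n); rewrite pr_tuple_map ddnn; case: ifP => //; lia.
Qed.

Lemma null_homotopic_factor (Y : ncomplex A N) (f : cmor X Y) :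
  null_homotopic f -> exists b : cmor contractible Y, f = cmorM b contractible_in.
Proof.
move=> /null_homotopicP [h fE].
pose G (i j m : int) : hom (I i) (Y j) := dd Y (m - N%:Z + 1) j ∘ h m ∘ pr i m.
pose b i := \sum_(k < N) G i i (i + k%:Z).
have bP n : cd Y n ∘ b n = b (n + 1) ∘ dI n.
  rewrite comp_sumr comp_suml.
  rewrite (eq_bigr (fun k : 'I_N => G n (n + 1) (n + k%:Z))); last first.
    move=> k _; have := ltn_ord k => kN.
    by rewrite /G !compA cdE dd_comp //; lia.
  rewrite [RHS](eq_bigr (fun k : 'I_N => G n (n + 1) (n + 1 + k%:Z))); last first.
    by move=> k _; rewrite /G -!compA pr_dI; case: ifP => //; lia.
  rewrite (sum_ord_first (fun k => G n (n + 1) (n + k%:Z))); last by lia.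
  rewrite (sum_ord_last (fun k => G n (n + 1) (n + 1 + k%:Z))); last by lia.
  rewrite {1}/G dd_ge0 ?comp0m ?add0r; last by lia.
  rewrite [X in _ = _ + X]/G /pr wprj0 ?compm0 ?addr0; last by lia.
  by apply: eq_bigr => k _; congr G; lia.
exists (@Cmor _ _ contractible Y b bP); apply: cmor_eq => i /=.
rewrite fE comp_suml; apply: eq_bigr => k _; rewrite /hterm /G -[RHS]compA.
by congr (_ ∘ _); rewrite pr_tuple_map; have := ltn_ord k; case: ifP => //; lia.
Qed.

End Contractible.

(** Chainwise split monomorphisms have a cokernel complex. *)
Lemma split_mono_conflation (X Y : ncomplex A N) (u : cmor X Y) :
  (forall n, exists r : hom (Y n) (X n), r ∘ u n = idm (X n)) ->
  exists (Z : ncomplex A N) (c : cmor Y Z), forall n, split_exact (u n) (c n).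
Proof.
move=> ur.
have dP n : exists d : hom (Coker (u n)) (Coker (u (n + 1))),
    d ∘ coker (u n) = coker (u (n + 1)) ∘ cd Y n.
  have [|d [dE _]] := (cokerP (u n)).2 _ (coker (u (n + 1)) ∘ cd Y n).
    by rewrite -compA cmapP compA (cokerP _).1 comp0m.
  by exists d.
pose d n := sval (cid (dP n)).
have dE n : d n ∘ coker (u n) = coker (u (n + 1)) ∘ cd Y n := svalP (cid (dP n)).
have ditE n r :
    diter d n r ∘ coker (u n) = coker (u (shift n r)) ∘ diter (cd Y) n r.
  elim: r => [|r IHr] /=; first by rewrite comp1m compm1.
  by rewrite -compA IHr !compA; congr (_ ∘ _); rewrite dE.
have dN n : diter d n N = 0.
  apply: (cokernel_epi (cokerP (u n))).
  by rewrite ditE cdN compm0 comp0m.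
exists (NComplex dN), (@Cmor _ _ Y (NComplex dN) (fun n => coker (u n)) dE) => n /=.
have [r rE] := ur n.
have um : mono (u n).
  by move=> W a b ab; rewrite -(comp1m a) -(comp1m b) -rE -!compA ab.
split; first exact: mono_short_exact.
have [|t [tE _]] := (cokerP (u n)).2 _ (idm _ - u n ∘ r).
  by rewrite compBl -compA rE comp1m compm1 subrr.
exists t; apply: (cokernel_epi (cokerP (u n))).
by rewrite -compA tE compBr compA (cokerP _).1 comp0m compm1 subr0 comp1m.
Qed.

(** Every complex [P] embeds in a contractible one, through which all
    null-homotopic maps out of [P] factor and which [F] sends to a
    projective-injective chain. *)
Lemma contractible_conflation (P : CNacP A N) :
  exists (Q R : CNacP A N) (i : hom P Q) (p : hom Q R),
    [/\ conf i p, null_homotopic (idm Q : cmor _ _), projinj (F A N Q)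
      & forall (S : CNacP A N) (f : hom P S), null_homotopic f ->
          exists b : hom Q S, f = b ∘ i].
Proof.
case: P => X [acX pX]; pose u := contractible_in X.
have [Z [c uc]] := split_mono_conflation (contractible_in_split X).
have acI := contractible_acyclic X; have pI := contractible_proj pX.
have acZ : acyclic Z by apply: (@acyclic_quotient X _ Z u c) => // n; have [] := uc n.
have pZ n : proj (Z n).
  by have [_ [t ct]] := uc n; exact: (proj_retract ct (pI n)).
exists (exist _ (contractible X) (conj acI pI)), (exist _ Z (conj acZ pZ)), u, c.
split=> //; first exact: contractible_null_homotopic.
- by apply: MMor_projinj => k; exact: contractible_Zproj.
- by move=> [S [acS pS]] f /= /null_homotopic_factor [b ->]; exists b.
Qed.

(** A projective-injective complex is a retract of its contractible complex. *)
Lemma F_projinj (P : CNacP A N) : projinj P -> projinj (F A N P).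
Proof.
move=> [_ iP]; have [Q [R [i [p [ip _ FQ _]]]]] := contractible_conflation P.
have [g gi] := iP _ _ _ _ _ ip (idm P).
by apply: (projinj_retract (s := fmap (F A N) i) (r := fmap (F A N) g)) => //;
  rewrite -fmapM gi fmap1.
Qed.

Lemma F_additive : additive_functor (F A N).
Proof.
move=> P Q f g; apply: mmor_eq => k; apply: Zin_mono.
by rewrite [LHS]ZmapE /= compDr !ZmapE compDl.
Qed.

Lemma F_respects : respects (htp_ideal_acP A N) (stab_ideal A N.-2) (F A N).
Proof.
move=> P S f g fg; rewrite -(additive_functorB F_additive).
have [Q [R [i [p [_ _ FQ fac]]]]] := contractible_conflation P.
have [b ->] := fac _ _ fg.
by exists (F A N Q), (fmap (F A N) i), (fmap (F A N) b); rewrite fmapM.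
Qed.

Lemma F_reflects_null_homotopic (P S : CNacP A N) (f : hom P S) :
  factors_projinj (fmap (F A N) f) -> null_homotopic f.
Proof.
move=> [E [a [b [[_ iE] FfE]]]].
have [Q [R [i [p [ip Q0 _ _]]]]] := contractible_conflation P.
have [a' a'E] := iE _ _ _ _ _ (F_exact ip) a.
have [g gE] := F_full (b ∘ a').
have gi0 : null_homotopic (g ∘ i : hom P S).
  have := null_homotopicL g (null_homotopicR i Q0).
  by rewrite -[cmorM (idm Q) i]/(idm Q ∘ i) comp1m.
have fgi0 : null_homotopic (f - g ∘ i).
  apply: F_map0_null_homotopic.
  by rewrite (additive_functorB F_additive) fmapM gE -compA a'E FfE subrr.
have -> : f = (f - g ∘ i) - (0 - g ∘ i) by rewrite sub0r opprK subrK.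
by apply: null_homotopicB fgi0 (null_homotopicB (null_homotopic0 _ _) gi0).
Qed.

(** * Realizing chains as cycles of acyclic complexes *)

(** A projective object with a family of maps into it, which stands for the
    family [S_r] of their images; the maps need not be monomorphisms. *)
Record filtered := Filtered {
  fl_ob : A;
  fl_map : nat -> {Y : A & hom Y fl_ob};
  fl_proj : proj fl_ob }.

(** Membership of an element in the step [S_r] of the filtration. *)
Definition fmem (s : filtered) (r : nat) (W : A) (w : hom W (fl_ob s)) :=
  exists v, projT2 (fl_map s r) ∘ v = w.

Lemma fmemD s r W (v w : hom W (fl_ob s)) : fmem r v -> fmem r w -> fmem r (v + w).
Proof. by move=> [a <-] [b <-]; exists (a + b); rewrite compDr. Qed.

(** The images increase from [0] to the whole object. *)
Definition is_filtration (s : filtered) :=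
  [/\ forall W (w : hom W (fl_ob s)), proj W -> fmem 0 w -> w = 0,
      forall r W (w : hom W (fl_ob s)), (r < N)%N -> proj W -> fmem r w -> fmem r.+1 w
    & forall W (w : hom W (fl_ob s)), proj W -> fmem N w].

(** A map [d] between filtered objects whose kernel lies in [S_1] and such that
    [S'_r = d S_(r+1)] for [r < N], as between the cycles in consecutive degrees of an
    acyclic complex. *)
Definition filtered_diff (s s' : filtered) (d : hom (fl_ob s) (fl_ob s')) :=
  (forall W (w : hom W (fl_ob s)), proj W -> d ∘ w = 0 -> fmem 1 w) /\
  (forall r W (w' : hom W (fl_ob s')), (r < N)%N -> proj W ->
     fmem r w' <-> exists w, fmem r.+1 w /\ d ∘ w = w').

(** The next degree is an embedding of the quotient by [S_1]. *)
Lemma filtered_up s : is_filtration s ->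
  exists s', is_filtration s' /\ exists d, @filtered_diff s s' d.
Proof.
move=> [s0 sS sN].
have [Q [q [pQ qm]]] := proj_embedding hA (Coker (projT2 (fl_map s 1))).
pose d := q ∘ coker (projT2 (fl_map s 1)).
pose z r : {Y : A & hom Y Q} :=
  if (r < N)%N then existT (fun Y => hom Y Q) _ (d ∘ projT2 (fl_map s r.+1))
  else existT (fun Y => hom Y Q) Q (idm Q).
pose s' := @Filtered Q z pQ.
have zE r W (w : hom W (fl_ob s')) : (r < N)%N ->
    fmem r w <-> exists v, fmem r.+1 v /\ d ∘ v = w.
  rewrite /fmem /= /z => ->; split=> [[v <-]|[_ [[v <-] <-]]].
    by exists (projT2 (fl_map s r.+1) ∘ v); split; [exists v | rewrite compA].
  by exists v; rewrite -compA.
have zN W (w : hom W (fl_ob s')) : fmem N w.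
  by rewrite /fmem /= /z ltnn; exists w; rewrite comp1m.
exists s'; split; last first.
  exists d; split=> [W w pW dw|r W w' rN pW]; last exact: zE.
  by apply: proj_lift => //; apply: (mono_eq0 qm); rewrite compA.
split=> //.
- move=> W w pW /zE [|_ [[v <-] <-]]; first by lia.
  by rewrite /d -compA (compA (coker _)) (cokerP _).1 comp0m compm0.
- move=> r W w rN pW; have [rN'|Nr] := ltnP r.+1 N; last first.
    by rewrite (_ : r.+1 = N) //; lia.
  by move=> /(zE _ _ _ rN) [v [vr vw]]; apply/zE => //; exists v; split=> //; exact: sS.
Qed.

Lemma fmem_le s r W (w : hom W (fl_ob s)) : is_filtration s -> proj W ->
  (r < N)%N -> fmem r w -> fmem N.-1 w.
Proof.
move=> [_ sS _] pW rN rw; have -> : N.-1 = (r + (N.-1 - r))%N by lia.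
have : (r + (N.-1 - r) <= N.-1)%N by lia.
elim: (N.-1 - r)%N => [|k IHk]; first by rewrite addn0.
by rewrite addnS => kN; apply: sS => //; [lia | apply: IHk; lia].
Qed.

(** The previous degree is a projective object with a map onto [S_(N-1)]. *)
Lemma filtered_down s' : is_filtration s' ->
  exists s, is_filtration s /\ exists d, @filtered_diff s s' d.
Proof.
move=> fs'; have [s0 sS sN] := fs'.
have [Q [p [pQ pe]]] := proj_cover hA (projT1 (fl_map s' N.-1)).
pose d := projT2 (fl_map s' N.-1) ∘ p.
pose z r : {Y : A & hom Y Q} :=
  if r is r'.+1 then existT (fun Y => hom Y Q) _ (ker (coker (projT2 (fl_map s' r')) ∘ d))
  else existT (fun Y => hom Y Q) Q 0.
pose s := @Filtered Q z pQ.
have z0 W (w : hom W (fl_ob s)) : fmem 0 w -> w = 0.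
  by rewrite /fmem /= => -[v <-]; rewrite comp0m.
have zE r W (w : hom W (fl_ob s)) : proj W -> fmem r.+1 w <-> fmem r (d ∘ w).
  move=> pW; rewrite {1}/fmem /=; split=> [[v <-]|[v vE]].
    by apply: proj_lift => //; rewrite !compA (kerP _).1 comp0m.
  have kw : coker (projT2 (fl_map s' r)) ∘ d ∘ w = 0.
    by rewrite -compA -vE compA (cokerP _).1 comp0m.
  by exists (klift kw); exact: kliftE.
have NE : N.-1.+1 = N by lia.
exists s; split; last first.
  exists d; split=> [W w pW dw|r W w' rN pW].
    by apply/zE => //; exists 0; rewrite dw compm0.
  split=> [rw'|[w [rw <-]]]; last exact/zE.
  have [v vE] := fmem_le fs' pW rN rw'.
  have [w wE] := proj_epi_lift v pW pe.
  have dw : d ∘ w = w' by rewrite -compA wE.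
  by exists w; split=> //; apply/zE; rewrite ?dw.
split=> [W w pW|[|r] W w rN pW|W w pW]; first exact: z0.
- by move=> /z0 ->; apply/zE => //; exists 0; rewrite !compm0.
- by move=> /zE - /(_ pW) rw; apply/zE => //; apply: sS => //; lia.
- by rewrite -NE; apply/zE => //; exists (p ∘ w); rewrite compA.
Qed.

(** Every filtration occurs as the filtration by cycles of an acyclic complex of
    projectives in degree 0. *)
Lemma filtered_complex (s : filtered) : is_filtration s ->
  exists (P : CNacP A N) (a : hom (fl_ob s) (sval P 0)), is_iso a /\
    forall r W (w : hom W (fl_ob s)), (r <= N)%N -> proj W ->
    dd (sval P) 0 r%:Z ∘ (a ∘ w) = 0 <-> fmem r w.
Proof.
move=> fs; pose T (n : int) := {s | is_filtration s}.
pose R n (x : T n) (y : T (n + 1)) := exists d, @filtered_diff (sval x) (sval y) d.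
have [||t [t0 tR]] := @int_dep_choice T R (exist _ s fs).
- move=> n [x fx]; have [y [fy xy]] := filtered_up fx.
  by exists (exist _ y fy).
- move=> n [y fy]; have [x [fx xy]] := filtered_down fy.
  by exists (exist _ x fx).
pose X n := fl_ob (sval (t n)).
pose d n : hom (X n) (X (n + 1)) := sval (cid (tR n)).
have dP n : filtered_diff (d n) := svalP (cid (tR n)).
have tf n : is_filtration (sval (t n)) := svalP (t n).
(* d^k maps S_(k+j) onto S_j; its kernel is S_k by [vanish] and [kernel] *)
have image n k j W (w' : hom W (X (shift n k))) : (k + j <= N)%N -> proj W ->
    fmem j w' <-> exists w : hom W (X n), fmem (k + j) w /\ diter d n k ∘ w = w'.
  move=> + pW; elim: k j w' => [|k IHk] j w' kjN /=.
    split=> [jw'|[w [jw <-]]]; last by rewrite comp1m.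
    by exists w'; rewrite comp1m.
  rewrite ((dP _).2 j) //; last by lia.
  rewrite addSnnS in kjN *; split=> [[w1 [/(IHk _ _ kjN) [w [kw <-]] <-]]|[w [kw <-]]].
    by exists w; rewrite compA.
  by exists (diter d n k ∘ w); rewrite compA; split=> //; apply/IHk => //; exists w.
have vanish n k W (w : hom W (X n)) : (k <= N)%N -> proj W ->
    fmem k w -> diter d n k ∘ w = 0.
  move=> kN pW kw; have [f0 _ _] := tf (shift n k).
  by apply: f0 => //; apply/image; rewrite ?addn0 //; exists w.
have kernel n k W (w : hom W (X n)) : (k <= N)%N -> proj W ->
    diter d n k ∘ w = 0 -> fmem k w.
  move=> + pW; elim: k w => [|k IHk] w kN /=.
    by rewrite comp1m => ->; exists 0; rewrite compm0.
  rewrite -compA => /((dP _).1 _ _ pW) /image [|//|w2 []]; first by lia.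
  rewrite addn1 => kw2 w2E.
  have -> : w = (w - w2) + w2 by rewrite subrK.
  apply: fmemD => //; have [_ fS _] := tf n; apply: fS => //.
  by apply: IHk; [lia | rewrite compBr w2E subrr].
have dN n : diter d n N = 0.
  apply: (proj_el_eq hA) => W w pW; rewrite comp0m; apply: vanish => //.
  by have [_ _ fN] := tf n; exact: fN.
pose C := NComplex dN.
have acC : acyclic C.
  apply/acyclicP => m n p mnp pE W w pW.
  have [k kE] : exists k, n = shift m k.
    by exists `|n - m|%N; rewrite shiftE; lia.
  have [j jE] : exists j, p = shift n j.
    by exists `|p - n|%N; rewrite shiftE; lia.
  have kj : (k + j = N)%N by move: jE kE; rewrite !shiftE; lia.
  move: w; rewrite jE -diterE kE => w dw.
  have /image [||v [_ vE]] : fmem j w by apply: kernel => //; lia.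
  - by rewrite kj.
  - by [].
  by exists v; rewrite -diterE.
pose P : CNacP A N := exist _ C (conj acC (fun n => @fl_proj (sval (t n)))).
suff : exists a : hom (fl_ob (sval (t 0))) (C 0), is_iso a /\
    forall r W (w : hom W (fl_ob (sval (t 0)))), (r <= N)%N -> proj W ->
    dd C 0 r%:Z ∘ (a ∘ w) = 0 <-> fmem r w.
  by rewrite t0; exists P.
exists (idm _); split=> [|r W w rN pW]; first by exists (idm _); rewrite comp1m.
rewrite comp1m; have -> : r%:Z = shift 0 r by rewrite shiftE add0r.
by rewrite -diterE; split; [exact: kernel | exact: vanish].
Qed.

Lemma F_dense (M : MMor A N.-2) :
  exists (P : CNacP A N) (a : hom M (F A N P)), is_iso a.
Proof.
have [Q [q [pQ qm]]] := proj_embedding hA (mob M ord_max).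
pose T k := {j : hom (mob M k) Q | mono j}.
pose R (i : 'I_N.-2) (x : T (widen_ord (leqnSn _) i)) (y : T (lift ord0 i)) :=
  sval y ∘ marr M i = sval x.
have [|t [_ tR]] := @ord_dep_choice_down N.-2 T R (exist _ q qm).
  move=> i [j jm]; suff jm' : mono (j ∘ marr M i) by exists (exist _ _ jm').
  by move=> W u v; rewrite -!compA => /jm /marr_mono.
pose j k := sval (t k); have jm k : mono (j k) := svalP (t k).
pose z r : {Y : A & hom Y Q} :=
  if r is r'.+1 then
    if (r' < N.-1)%N then existT (fun Y => hom Y Q) _ (j (inord r'))
    else existT (fun Y => hom Y Q) Q (idm Q)
  else existT (fun Y => hom Y Q) Q 0.
pose s := @Filtered Q z pQ.
have zN r W (w : hom W (fl_ob s)) : (N.-1 <= r)%N -> fmem r.+1 w.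
  by rewrite /fmem /= leqNgt => /negPf ->; exists w; rewrite comp1m.
have zE (k : 'I_N.-2.+1) W (w : hom W (fl_ob s)) :
    fmem k.+1 w <-> exists v, j k ∘ v = w.
  have kN : (k < N.-1)%N by have := ltn_ord k; lia.
  by rewrite /fmem /= kN inord_val.
have fs : is_filtration s.
  split=> [W w pW|r W w rN pW|W w pW].
  - by rewrite /fmem /= => -[v <-]; rewrite comp0m.
  - case: r rN => [|r] rN.
      by rewrite {1}/fmem /= => -[v <-]; exists 0; rewrite comp0m compm0.
    have [rN'|/zN //] := ltnP r.+1 N.-1.
    have rN2 : (r < N.-2)%N by lia.
    move=> /(zE (widen_ord (leqnSn _) (Ordinal rN2))) [v <-].
    apply/(zE (lift ord0 (Ordinal rN2))); exists (marr M (Ordinal rN2) ∘ v).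
    by rewrite compA tR.
  - by have -> : N = N.-1.+1 by [lia]; exact: zN.
have [P [a [[b [ba ab]] aE]]] := filtered_complex fs.
pose X : ncomplex A N := sval P; exists P.
have am : mono a by move=> W u v uv; rewrite -(comp1m u) -(comp1m v) -ba -!compA uv.
have kN (k : 'I_N.-2.+1) : (k.+1 <= N)%N by have := ltn_ord k; lia.
have to (k : 'I_N.-2.+1) : exists f, Zin X 0 k.+1 ∘ f = a ∘ j k.
  apply: (proj_el_factor hA) => [|W w pW]; first exact: Zin_mono.
  apply: Zin_factor; rewrite -compA; apply/aE => //.
  by apply/zE; exists w.
have from (k : 'I_N.-2.+1) : exists g, a ∘ j k ∘ g = Zin X 0 k.+1.
  apply: (proj_el_factor hA) => [|W w pW].
    by move=> V u v; rewrite -!compA => /am /jm.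
  have /zE [v vE] : @fmem s k.+1 W (b ∘ (Zin X 0 k.+1 ∘ w)).
    by apply/aE => //; rewrite (compA a) ab comp1m compA dd_Zin comp0m.
  by exists v; rewrite -compA vE compA ab comp1m.
pose f k := sval (cid (to k)).
have fE (k : 'I_N.-2.+1) : Zin X 0 k.+1 ∘ f k = a ∘ j k := svalP (cid (to k)).
pose g k := sval (cid (from k)).
have gE (k : 'I_N.-2.+1) : a ∘ j k ∘ g k = Zin X 0 k.+1 := svalP (cid (from k)).
have fP i : f (lift ord0 i) ∘ marr M i = Zincl X 0 i.+1 ∘ f (widen_ord (leqnSn _) i).
  apply: (@Zin_mono _ _ X 0 i.+2); rewrite (compA _ (Zincl _ _ _)) ZinclE fE.
  by rewrite compA fE -compA tR.
have gP i : g (lift ord0 i) ∘ Zincl X 0 i.+1 = marr M i ∘ g (widen_ord (leqnSn _) i).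
  apply: (jm (lift ord0 i)); apply: am.
  rewrite !compA gE [LHS]ZinclE -(compA a) tR.
  exact: (esym (gE (widen_ord (leqnSn _) i))).
exists (@Mmor _ _ M (F A N P) f fP), (@Mmor _ _ (F A N P) M g gP).
split; apply: mmor_eq => k /=.
- by apply: (jm k); apply: am; rewrite !compA gE fE compm1.
- by apply: Zin_mono; rewrite compA fE gE compm1.
Qed.

End AcyclicComplexes.

(** * Equivalences *)

Lemma equivalence_criterion (C D : preadd) (G : functor C D) :
  (forall (X Y : C) (g : hom (G X) (G Y)), exists f, fmap G f = g) ->
  (forall (X Y : C) (f f' : hom X Y), fmap G f = fmap G f' -> f = f') ->
  (forall Y : D, exists (X : C) (a : hom Y (G X)), is_iso a) ->
  is_equivalence G.
Proof.
move=> full faithful dense.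
pose o Y : C := sval (cid (dense Y)).
have aP Y : exists a : hom Y (G (o Y)), is_iso a := svalP (cid (dense Y)).
pose a Y := sval (cid (aP Y)); pose b Y := sval (cid (svalP (cid (aP Y)))).
have ba Y : b Y ∘ a Y = idm Y := (svalP (cid (svalP (cid (aP Y))))).1.
have ab Y : a Y ∘ b Y = idm (G (o Y)) := (svalP (cid (svalP (cid (aP Y))))).2.
pose lift X Y (g : hom (G X) (G Y)) := sval (cid (full X Y g)).
have liftE X Y (g : hom (G X) (G Y)) : fmap G (lift X Y g) = g.
  exact: svalP (cid (full X Y g)).
pose h Y Z (g : hom Y Z) : hom (o Y) (o Z) := lift _ _ (a Z ∘ g ∘ b Y).
have h1 Y : h Y Y (idm Y) = idm (o Y).
  by apply: faithful; rewrite liftE compm1 ab fmap1.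
have hM X Y Z (g : hom Y Z) (f : hom X Y) : h X Z (g ∘ f) = h Y Z g ∘ h X Y f.
  apply: faithful; rewrite fmapM !liftE !compA -(compA (a Z ∘ g) (b Y)) ba.
  by rewrite compm1.
exists (@Functor D C o h h1 hM); split.
- exists (fun X => lift _ _ (b (G X))); split=> [X Y f|X] /=.
    by apply: faithful; rewrite !fmapM !liftE !compA ba comp1m.
  by exists (lift _ _ (a (G X))); split; apply: faithful;
    rewrite fmapM !liftE fmap1 ?ab ?ba.
- exists b; split=> [X Y f|X] /=; last by exists (a X).
  by rewrite liftE !compA ba comp1m.
Qed.

(** * Triangulated functors *)

(** A class of conflations whose second maps are cokernels of the first ones. *)
Definition cokernel_conflations (E : excat) :=
  forall (X Y Z : E) (i : hom X Y) (p : hom Y Z), conf i p ->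
  [/\ p ∘ i = 0, epi p
    & forall (W : E) (g : hom Y W), g ∘ i = 0 -> exists c, c ∘ p = g].

Section Conflations.
Variable E : excat.
Hypothesis cokE : cokernel_conflations E.

Variables (X I S X' I' S' : E) (i : hom X I) (p : hom I S).
Variables (i' : hom X' I') (p' : hom I' S').
Hypotheses (ip : conf i p) (ip' : conf i' p') (I'inj : projinj I').

Lemma conf_map (f : hom X X') : exists (u : hom I I') (g : hom S S'),
  u ∘ i = i' ∘ f /\ g ∘ p = p' ∘ u.
Proof.
have [u uE] := I'inj.2 _ _ _ _ _ ip (i' ∘ f).
have [_ _ fac] := cokE ip; have [p'i' _ _] := cokE ip'.
have [|g gE] := fac _ (p' ∘ u); last by exists u, g.
by rewrite -compA uE compA p'i' comp0m.
Qed.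

(** The map induced on the last terms is determined by the one on the first
    terms, modulo maps that factor through projective-injective objects. *)
Lemma conf_map_stable (f f' : hom X X') (u u' : hom I I') (g g' : hom S S') :
  u ∘ i = i' ∘ f -> g ∘ p = p' ∘ u -> u' ∘ i = i' ∘ f' -> g' ∘ p = p' ∘ u' ->
  factors_projinj (f - f') -> factors_projinj (g - g').
Proof.
move=> ui gp ui' gp' [Q [a [b [[_ iQ] ff']]]].
have [a' a'E] := iQ _ _ _ _ _ ip a.
have [_ pe fac] := cokE ip; have [p'i' _ _] := cokE ip'.
have [|c cE] := fac _ (u - u' - i' ∘ b ∘ a').
  by rewrite !compBl ui ui' -compBr -!compA a'E ff' subrr.
exists I', c, p'; split=> //; apply: pe.
by rewrite -compA cE compBl gp gp' !compBr !compA p'i' !comp0m subr0.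
Qed.

End Conflations.

Lemma MMor_cokernel_conflations (A : abcat) m : cokernel_conflations (MMor A m).
Proof.
move=> X Y Z i p ip.
have pe k : epi (mmap p k) by exact: cokernel_epi (ip k).2.
split.
- by apply: mmor_eq => k; exact: (ip k).1.1.
- move=> W u v /(congr1 (fun f => mmap f)) uv; apply: mmor_eq => k.
  by apply: pe; exact: (congr1 (fun f => f k) uv).
- move=> W g gi.
  have fac k : exists c, c ∘ mmap p k = mmap g k.
    have [|c [cE _]] := (ip k).2.2 _ (mmap g k); last by exists c.
    exact: (congr1 (fun f => mmap f k) gi).
  pose c k := sval (cid (fac k)).
  have cE k : c k ∘ mmap p k = mmap g k := svalP (cid (fac k)).
  have cP j : c (lift ord0 j) ∘ marr Z j = marr W j ∘ c (widen_ord (leqnSn m) j).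
    by apply: pe; rewrite -!compA -mmapP cE compA cE mmapP.
  by exists (@Mmor A m Z W c cP); apply: mmor_eq.
Qed.

Section InducedTriangulated.
Variables (E1 E2 : excat) (J1 : ideal E1) (addE : Defs.additive E2).
Variable G : functor E1 E2.
Let J2 := stable_ideal addE.
Hypothesis hG : respects J1 J2 G.
Hypothesis cokE : cokernel_conflations E2.
Hypothesis Gadd : additive_functor G.
Hypothesis Gexact : forall (X Y Z : E1) (i : hom X Y) (p : hom Y Z),
  conf i p -> conf (fmap G i) (fmap G p).
Hypothesis Gprojinj : forall P : E1, projinj P -> projinj (G P).

Let Gbar : functor (quotient J1) (quotient J2) := induced hG.

Let GbarE (X Y : E1) (f : hom X Y) :
  @fmap _ _ Gbar X Y (cls J1 f) = cls J2 (fmap G f).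
Proof. exact: ind_mapE. Qed.

Let qE (X Y Z : E2) (g : hom Y Z) (f : hom X Y) :
  @comp (quotient J2) X Y Z (cls J2 g) (cls J2 f) = cls J2 (g ∘ f).
Proof. exact: qcompE. Qed.

Lemma induced_additive : additive_functor Gbar.
Proof.
move=> X Y a b; rewrite -(clsK a) -(clsK b) -[X in fmap Gbar X]clsD !GbarE.
by rewrite Gadd -clsD.
Qed.

Lemma fmap_iso (C D : preadd) (K : functor C D) (X Y : C) (f : hom X Y) :
  is_iso f -> is_iso (fmap K f).
Proof. by move=> [g [gf fg]]; exists (fmap K g); rewrite -!fmapM gf fg !fmap1. Qed.

(** An additive exact functor that preserves projective-injective objects
    induces a triangulated functor: it sends the chosen conflation
    [X -> I -> S X] to one that also computes the suspension of [G X]. *)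
Lemma induced_triangulated : triangulated_functor Gbar.
Proof.
split=> [|s1 s2]; first exact: induced_additive.
have c1 X : conf (fmap G (s_in (s1 X))) (fmap G (s_out (s1 X))).
  exact/Gexact/s_conf.
have c2 X : conf (s_in (s2 X)) (s_out (s2 X)) by exact: s_conf.
have i1 X : projinj (G (sI (s1 X))) by exact/Gprojinj/s_projinj.
have i2 X : projinj (sI (s2 X)) by exact: s_projinj.
have jP X := conf_map cokE (c1 X) (c2 (G X)) (i2 (G X)) (idm (G X)).
pose j X := sval (cid (jP X)); pose t X := sval (cid (svalP (cid (jP X)))).
have jE X : j X ∘ fmap G (s_in (s1 X)) = s_in (s2 (G X)) ∘ idm (G X).
  exact: (svalP (cid (svalP (cid (jP X))))).1.
have tE X : t X ∘ fmap G (s_out (s1 X)) = s_out (s2 (G X)) ∘ j X.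
  exact: (svalP (cid (svalP (cid (jP X))))).2.
pose T X : @hom (quotient J2) (G (sS (s1 X))) (sS (s2 (G X))) := cls J2 (t X).
have nat (X Y : E1) (f : @hom (quotient J1) X Y)
    (g : @hom (quotient J1) (sS (s1 X)) (sS (s1 Y)))
    (g' : @hom (quotient J2) (sS (s2 (G X))) (sS (s2 (G Y)))) :
    susp_map f g -> susp_map (fmap Gbar f) g' ->
    g' ∘ T X = T Y ∘ fmap Gbar g.
  move=> [f0 [u0 [g0 [<- <- u0E g0E]]]] [f1 [u1 [g1 [f1E <- u1E g1E]]]].
  rewrite !GbarE in f1E *; rewrite !qE; apply/clsP.
  apply: (conf_map_stable cokE (c1 X) (c2 (G Y)) (i2 (G Y))
    (f := f1) (f' := fmap G f0) (u := u1 ∘ j X) (u' := j Y ∘ fmap G u0)).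
  - by rewrite -compA jE compm1.
  - by rewrite -compA tE compA g1E compA.
  - by rewrite -compA -fmapM u0E fmapM compA jE compm1.
  - by rewrite -compA -fmapM g0E fmapM compA tE compA.
  - by move/clsP: f1E.
exists T; split=> [X|//|X Y Z u v w].
- have [k [r [kE rE]]] := conf_map cokE (c2 (G X)) (c1 X) (i1 X) (idm (G X)).
  exists (cls J2 r); split; rewrite qE; apply/clsP.
  + apply: (conf_map_stable cokE (c1 X) (c1 X) (i1 X)
      (f := idm _) (f' := idm _) (u := k ∘ j X) (u' := idm _)).
    * by rewrite -compA jE compm1 kE.
    * by rewrite -compA tE [LHS]compA rE compA.
    * by rewrite comp1m compm1.
    * by rewrite comp1m compm1.
    * by rewrite subrr; exact: factors_projinj0.
  + apply: (conf_map_stable cokE (c2 (G X)) (c2 (G X)) (i2 (G X))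
      (f := idm _) (f' := idm _) (u := j X ∘ k) (u' := idm _)).
    * by rewrite -compA kE compm1 jE.
    * by rewrite -compA rE [LHS]compA tE compA.
    * by rewrite comp1m compm1.
    * by rewrite comp1m compm1.
    * by rewrite subrr; exact: factors_projinj0.
- move=> [X' [Y' [Z' [u' [v' [w' [a [b [c [Sa]]]]]]]]]].
  move=> [[u0 [v0 [i0 [w0 [uv iu wv [-> -> ->]]]]]] ia ib ic [sa bu cv Saw]].
  have [Sa' sa'] : exists Sa' : @hom (quotient J2) (sS (s2 (G X))) (sS (s2 (G X'))),
      susp_map (fmap Gbar a) Sa'.
    have [l [m [lE mE]]] := conf_map cokE (c2 (G X)) (c2 (G X')) (i2 (G X'))
      (repr (fmap Gbar a)).
    by exists (cls J2 m), (repr (fmap Gbar a)), l, m; rewrite clsK.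
  exists (G X'), (G Y'), (G Z'), (cls J2 (fmap G u0)), (cls J2 (fmap G v0)).
  exists (cls J2 (- (t X' ∘ fmap G w0))).
  exists (fmap Gbar a), (fmap Gbar b), (fmap Gbar c), Sa'.
  split; try exact: fmap_iso.
  + exists (fmap G u0), (fmap G v0), (j X' ∘ fmap G i0), (t X' ∘ fmap G w0).
    split=> //; first exact: Gexact.
      by rewrite -compA -fmapM iu jE compm1.
    by rewrite -compA -fmapM wv fmapM compA tE compA.
  + split=> //.
    * by rewrite -fmapM bu fmapM GbarE.
    * by rewrite -fmapM cv fmapM GbarE.
    * rewrite compA (nat _ _ _ _ _ sa sa') -compA -fmapM Saw fmapM GbarE.
      have G0 : fmap G (0 : hom Z' (sS (s1 X'))) = 0.
        by rewrite -[0](subrr 0) (additive_functorB Gadd) subrr.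
      have GN : fmap G (- w0) = - fmap G w0.
        by rewrite -[- w0]sub0r (additive_functorB Gadd) G0 sub0r.
      rewrite [LHS]compA; congr (_ ∘ _).
      by rewrite [LHS]qE GN compNr.
Qed.
End InducedTriangulated.

(** * The equivalence *)

Theorem theorem4p11 (A : abcat) (N : nat) (hN : (2 <= N)%N)
    (hA : frobenius (ab_excat A)) :
  exists hF : respects (htp_ideal_acP A N) (stab_ideal A N.-2) (F A N),
    triangulated_functor (induced hF : functor (KNacP A N) (stab A N.-2)) /\
    is_equivalence (induced hF : functor (KNacP A N) (stab A N.-2)).
Proof.
exists (F_respects hA hN); split.
  apply: induced_triangulated.
  - exact: MMor_cokernel_conflations.
  - exact: F_additive.
  - by move=> *; apply: F_exact.
  - by move=> *; apply: F_projinj.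
have FE (X Y : CNacP A N) (f : hom X Y) :
    @fmap (KNacP A N) (stab A N.-2) (induced (F_respects hA hN)) X Y
      (cls (htp_ideal_acP A N) f) = cls (stab_ideal A N.-2) (fmap (F A N) f).
  exact: (@ind_mapE _ _ _ _ _ (F_respects hA hN) X Y f).
apply: equivalence_criterion => [X Y g|X Y f f'|M].
- have [f fE] := F_full hA hN (repr g).
  by exists (cls (htp_ideal_acP A N) f); rewrite [LHS]FE fE [LHS]clsK.
- rewrite -(clsK f) -(clsK f') !FE => /clsP.
  rewrite -(additive_functorB (@F_additive A N)) => FB.
  by apply/clsP; exact: (F_reflects_null_homotopic hA hN FB).
- have [P [a [b [ba ab]]]] := F_dense hA hN M.
  exists P, (cls (stab_ideal A N.-2) a), (cls (stab_ideal A N.-2) b).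
  by split; rewrite [LHS]qcompE ?ba ?ab.
Qed.
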